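(* Let $$N(x)=\sum_{k\ge1}x^kq^{-\binom k2}\frac{\big((-q;q)_{k-1}\big)^2}{1-q^k},\qquad S(x)=\sum_{k\ge1}x^kq^{-\binom{k+1}2}(-q;q)_{k-1}(-q;q)_k,$$ so that $S(x)=N(x/q)-N(xq)$. Then $$B^{(a)}(x)=1+S(xq)-xS(x)A(x),\qquad L(x)=N(x)-xS(x)B^{(a)}(x).$$
   Context: Heaps over a path: for $n\ge1$, a heap over the $n$-point path is an equivalence class of finite words on the alphabet $\{1,\dots,n\}$ under the equivalence generated by exchanging two adjacent letters $i,j$ with $|i-j|\ge2$; its size is the length of a representative, and the number of points in column $i$ is the number of occurrences of $i$ (column $1$ is the first column, column $n$ the last). It is alternating if, for each $i\in\{1,\dots,n-1\}$, in a (equivalently any) representative the occurrences of the letters $i$ and $i+1$ alternate (the subword formed by these two letters has no two equal consecutive letters). The $0$-point (empty) path carries only the empty heap. $B^{(a)}(x)=\sum_{n\ge0}x^n\sum_Hq^{|H|}$, where $H$ runs over alternating heaps over the $n$-point path with at most one point in the last column (the $n=0$ term is $1$). $L(x)=\sum_{n\ge1}x^n\sum_Hq^{|H|}$ over all alternating heaps $H$ over the $n$-point path. $A(x)=\sum_{n\ge0}A_n^{FC}(q)x^n$ is the length generating function of fully commutative elements of the Coxeter groups $A_n$ (symmetric group on $n+1$ letters with adjacent transpositions; $A_0$ trivial); an element is fully commutative if any two reduced expressions are related by commutation relations only. $(a;q)_n=(1-a)(1-aq)\cdots(1-aq^{n-1})$. *)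

(* Defs.v *)
From HB Require Import structures.
From mathcomp Require Import all_boot all_order all_fingroup all_algebra.
From mathcomp Require Import boolp.
From Stdlib Require Import Relation_Operators.

Set Implicit Arguments.
Unset Strict Implicit.
Unset Printing Implicit Defensive.

Import GRing.Theory.

Local Open Scope ring_scope.

Record fps (R : Type) := Fps { fps_coef :> nat -> R }.

HB.instance Definition _ (R : Type) := gen_eqMixin (fps R).
HB.instance Definition _ (R : Type) := gen_choiceMixin (fps R).

Lemma fpsP (R : Type) (f g : fps R) : f =1 g <-> f = g.
Proof.
split=> [|-> //]; case: f => f; case: g => g /= fg.
by congr Fps; apply: funext.
Qed.

Section FpsZmod.
Variable R : zmodType.
Implicit Types f g h : fps R.

Definition fps_zero : fps R := Fps (fun=> 0).
Definition fps_opp f : fps R := Fps (fun n => - f n).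
Definition fps_add f g : fps R := Fps (fun n => f n + g n).

Fact fps_addA : associative fps_add.
Proof. by move=> f g h; apply/fpsP => n /=; rewrite addrA. Qed.
Fact fps_addC : commutative fps_add.
Proof. by move=> f g; apply/fpsP => n /=; rewrite addrC. Qed.
Fact fps_add0 : left_id fps_zero fps_add.
Proof. by move=> f; apply/fpsP => n /=; rewrite add0r. Qed.
Fact fps_addN : left_inverse fps_zero fps_opp fps_add.
Proof. by move=> f; apply/fpsP => n /=; rewrite addNr. Qed.

HB.instance Definition _ :=
  GRing.isZmodule.Build (fps R) fps_addA fps_addC fps_add0 fps_addN.

Lemma coef_fps0 n : (0 : fps R) n = 0. Proof. by []. Qed.
Lemma coef_fpsN f n : (- f) n = - f n. Proof. by []. Qed.
Lemma coef_fpsD f g n : (f + g) n = f n + g n. Proof. by []. Qed.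
Lemma coef_fpsB f g n : (f - g) n = f n - g n. Proof. by []. Qed.

End FpsZmod.

Section FpsComRing.
Variable R : comNzRingType.
Implicit Types f g h : fps R.

Definition fps_one : fps R := Fps (fun n => (n == 0%N)%:R).
Definition fps_mul f g : fps R :=
  Fps (fun n => \sum_(i < n.+1) f i * g (n - i)%N).

Definition fps_trunc (m : nat) f : {poly R} := \poly_(i < m) f i.

Fact fps_mul_trunc m f g n : (n < m)%N ->
  fps_mul f g n = (fps_trunc m f * fps_trunc m g)`_n.
Proof.
move=> ltnm; rewrite coefM /=; apply: eq_bigr => i _.
rewrite !coef_poly (leq_trans (ltn_ord i) ltnm).
by rewrite (leq_ltn_trans (leq_subr i n) ltnm).
Qed.

Fact fps_mulC : commutative fps_mul.
Proof.
by move=> f g; apply/fpsP => n; rewrite !(@fps_mul_trunc n.+1) // mulrC.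
Qed.

Fact fps_mulA : associative fps_mul.
Proof.
move=> f g h; apply/fpsP => n.
pose t := fps_trunc n.+1.
transitivity ((t f * (t g * t h))`_n).
  rewrite coefM /=; apply: eq_bigr => i _.
  rewrite coef_poly ltn_ord; congr (_ * _).
  by rewrite -fps_mul_trunc // ltnS leq_subr.
rewrite mulrA coefM /=; apply: eq_bigr => i _.
rewrite (coef_poly n.+1 h) ltnS leq_subr; congr (_ * _).
by rewrite -fps_mul_trunc.
Qed.

Fact fps_mul1 : left_id fps_one fps_mul.
Proof.
move=> f; apply/fpsP => n /=.
rewrite big_ord_recl /= mul1r subn0 big1 ?addr0 // => i _.
by rewrite /= mul0r.
Qed.

Fact fps_mulDl : left_distributive fps_mul +%R.
Proof.
move=> f g h; apply/fpsP => n /=.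
by rewrite -big_split /=; apply: eq_bigr => i _; rewrite mulrDl.
Qed.

Fact fps_one_neq0 : fps_one != 0.
Proof. by apply/eqP => /fpsP/(_ 0%N)/eqP; rewrite /= oner_eq0. Qed.

HB.instance Definition _ := GRing.Zmodule_isComNzRing.Build (fps R)
  fps_mulA fps_mulC fps_mul1 fps_mulDl fps_one_neq0.

Lemma coef_fps1 n : (1 : fps R) n = (n == 0%N)%:R. Proof. by []. Qed.
Lemma coef_fpsM f g n : (f * g) n = \sum_(i < n.+1) f i * g (n - i)%N.
Proof. by []. Qed.

Definition fpsX : fps R := Fps (fun n => (n == 1%N)%:R).

(* the substitution f(c x) *)
Definition fps_scale (c : R) f : fps R := Fps (fun n => c ^+ n * f n).

Definition fps_unit : {pred fps R} := fun f => `[< exists g, g * f = 1 >].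
Definition fps_inv f : fps R :=
  if pselect (exists g, g * f = 1) is left fV then projT1 (cid fV) else f.

Fact fps_mulV : {in fps_unit, left_inverse 1 fps_inv *%R}.
Proof.
move=> f /asboolP fU; rewrite /fps_inv; case: pselect => // fV.
exact: (projT2 (cid fV)).
Qed.
Fact fps_unitPl f g : g * f = 1 -> fps_unit f.
Proof. by move=> gf1; apply/asboolP; exists g. Qed.
Fact fps_inv_out : {in [predC fps_unit], fps_inv =1 id}.
Proof.
move=> f /asboolP fNU; rewrite /fps_inv; case: pselect => // fV.
Qed.

HB.instance Definition _ := GRing.ComNzRing_hasMulInverse.Build (fps R)
  fps_mulV fps_unitPl fps_inv_out.

End FpsComRing.

Section FpsIdomain.
Variable R : idomainType.

Fact fps_neq0_order (f : fps R) : f != 0 ->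
  exists2 i, f i != 0 & forall j, (j < i)%N -> f j = 0.
Proof.
move=> f0; have exf : exists i, f i != 0.
  apply: contrapT => nex; move/eqP: f0; apply; apply/fpsP => i.
  by apply/eqP; apply: contrapT => fi; apply: nex; exists i; apply/negP.
case: (ex_minnP exf) => i fi mini; exists i => // j ltji.
by apply/eqP; apply: contraTT ltji => /mini; rewrite -leqNgt.
Qed.

Fact fps_integral : GRing.integral_domain_axiom (fps R).
Proof.
move=> f g fg0; apply/norP => -[/fps_neq0_order[i fi f0]].
move=> /fps_neq0_order[j gj g0].
have /fpsP/(_ (i + j)%N) := fg0; rewrite coef_fpsM coef_fps0.
have lti : (i < (i + j).+1)%N by rewrite ltnS leq_addr.
rewrite (bigD1 (Ordinal lti)) //= addKn big1 ?addr0 => [|k nki].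
  by apply/eqP; rewrite mulf_neq0.
case: (ltngtP k i) => [/f0 -> | ltik | eqki].
- by rewrite mul0r.
- by rewrite g0 ?mulr0 // ltn_subLR ?ltn_add2r // -ltnS ltn_ord.
- by case/eqP: nki; apply: val_inj.
Qed.

HB.instance Definition _ :=
  GRing.ComUnitRing_isIntegral.Build (fps R) fps_integral.

End FpsIdomain.

(* Q((q)) as the fraction field of Q[[q]] *)
Notation laurent := {fraction fps rat}.
Notation laurent_of_fps := (@FracField.tofrac (fps rat)).

Definition q : laurent := laurent_of_fps (fpsX rat).

(* Columns 1, ..., n of the n-point path are numbered from 0 in 'I_n; the same
   letters index the adjacent transpositions generating 'S_n.+1 below. *)
Inductive comm_step (n : nat) : seq 'I_n -> seq 'I_n -> Prop :=
  CommStep (u v : seq 'I_n) (i j : 'I_n) :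
    (i.+1 < j)%N || (j.+1 < i)%N ->
    comm_step (u ++ [:: i, j & v]) (u ++ [:: j, i & v]).

Definition comm_equiv (n : nat) : seq 'I_n -> seq 'I_n -> Prop :=
  clos_refl_sym_trans (seq 'I_n) (@comm_step n).

(* the heaps of size m, each one being its set of representatives *)
Definition heaps (n m : nat) : {set {set m.-tuple 'I_n}} :=
  equivalence_partition
    (fun u v : m.-tuple 'I_n => `[< comm_equiv u v >]) [set: m.-tuple 'I_n].

Definition alternating_word (n : nat) (w : seq 'I_n) : bool :=
  [forall i : 'I_n, (i.+1 < n)%N ==>
     sorted (fun a b : 'I_n => a != b)
       [seq a : 'I_n <- w | (a == i :> nat) || (a == i.+1 :> nat)]].

(* Independent of the representative: see alternatingP and
   last_column_le1P below. *)
Definition alternating (n m : nat) (H : {set m.-tuple 'I_n}) : bool :=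
  [exists w in H, alternating_word w].

Definition last_column_le1 (n m : nat) (H : {set m.-tuple 'I_n}) : bool :=
  [exists w in H, (count (fun a : 'I_n => a.+1 == n) w <= 1)%N].

Lemma comm_equiv_filter (n : nat) (P : pred 'I_n) (u v : seq 'I_n) :
  (forall i j, P i -> P j -> ~~ ((i.+1 < j)%N || (j.+1 < i)%N)) ->
  comm_equiv u v -> filter P u = filter P v.
Proof.
move=> Pnear; elim=> [_ _ [{}u {}v i j far]|//|x y _ -> //|x y z _ -> _ -> //].
rewrite !filter_cat /=; case Pi: (P i); case Pj: (P j) => //.
by have := Pnear i j Pi Pj; rewrite far.
Qed.

Lemma comm_equiv_alternating (n : nat) (u v : seq 'I_n) :
  comm_equiv u v -> alternating_word u = alternating_word v.
Proof.
move=> uv; apply: eq_forallb => i; congr (_ ==> sorted _ _).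
apply: comm_equiv_filter uv => a b /orP[]/eqP-> /orP[]/eqP->;
  by rewrite negb_or -!leqNgt ?leqnn ?leqnSn ?(leqW (leqnSn _)).
Qed.

Lemma comm_equiv_count (n : nat) (P : pred 'I_n) (u v : seq 'I_n) :
  comm_equiv u v -> count P u = count P v.
Proof.
elim=> [_ _ [{}u {}v i j _]|//|x y _ -> //|x y z _ -> _ -> //].
by rewrite !count_cat /= (addnCA (P i)).
Qed.

Lemma comm_equivb_equivalence (n m : nat) :
  {in [set: m.-tuple 'I_n] & &, equivalence_rel
    (fun u v : m.-tuple 'I_n => `[< comm_equiv u v >])}.
Proof.
move=> u v w _ _ _; split; first by apply/asboolP; apply: rst_refl.
move=> /asboolP uv; apply/asboolP/asboolP.
  by apply: rst_trans; apply: rst_sym.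
exact: rst_trans.
Qed.

Lemma comm_equiv_heap (n m : nat) (H : {set m.-tuple 'I_n}) u v :
  H \in heaps n m -> u \in H -> v \in H -> comm_equiv u v.
Proof.
case/imsetP=> w _ ->; rewrite !inE /= => /asboolP wu /asboolP wv.
by apply: rst_trans wv; apply: rst_sym.
Qed.

Lemma alternatingP (n m : nat) (H : {set m.-tuple 'I_n}) : H \in heaps n m ->
  alternating H = [forall w in H, alternating_word w].
Proof.
move=> HH; apply/existsP/forall_inP => [[w /andP[Hw altw]] u Hu | allH].
  by rewrite -(comm_equiv_alternating (comm_equiv_heap HH Hw Hu)).
case/imsetP: (HH) => w _ eqH; have Hw : w \in H.
  by rewrite eqH !inE /=; apply/asboolP; apply: rst_refl.
by exists w; rewrite Hw allH.
Qed.

Lemma last_column_le1P (n m : nat) (H : {set m.-tuple 'I_n}) :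
  H \in heaps n m ->
  last_column_le1 H =
    [forall w in H, (count (fun a : 'I_n => a.+1 == n) w <= 1)%N].
Proof.
move=> HH; apply/existsP/forall_inP => [[w /andP[Hw lew]] u Hu | allH].
  by rewrite -(comm_equiv_count _ (comm_equiv_heap HH Hw Hu)).
case/imsetP: (HH) => w _ eqH; have Hw : w \in H.
  by rewrite eqH !inE /=; apply/asboolP; apply: rst_refl.
by exists w; rewrite Hw allH.
Qed.

Definition adj_tperm (n : nat) (i : 'I_n) : 'S_n.+1 :=
  tperm (widen_ord (leqnSn n) i) (lift ord0 i).

Definition word_perm (n : nat) (w : seq 'I_n) : 'S_n.+1 :=
  (\prod_(i <- w) adj_tperm i)%g.

Definition has_expr (n : nat) (g : 'S_n.+1) : pred nat :=
  fun m => [exists w : m.-tuple 'I_n, word_perm w == g].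

Lemma word_perm_surj (n : nat) (g : 'S_n.+1) : exists w, word_perm w = g.
Proof.
have catP (u v : seq 'I_n) : word_perm (u ++ v) = (word_perm u * word_perm v)%g.
  by rewrite /word_perm big_cat.
have tpP d (x y : 'I_n.+1) : (y = x + d :> nat)%N ->
    exists w, word_perm w = tperm x y.
  elim: d x y => [|d IHd] x y yE.
    exists [::]; rewrite /word_perm big_nil (_ : y = x) ?tperm1 //.
    by apply: val_inj; rewrite /= yE addn0.
  have ltxn : (x < n)%N.
    rewrite -ltnS (leq_trans _ (ltn_ord y)) //.
    by rewrite yE ltnS addnS ltnS leq_addr.
  pose i := Ordinal ltxn; pose x' := lift ord0 i : 'I_n.+1.
  have xE : widen_ord (leqnSn n) i = x by apply: val_inj.
  have sE : word_perm [:: i] = tperm x x'.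
    by rewrite /word_perm big_seq1 /adj_tperm xE.
  case: d IHd yE => [|d] IHd yE.
    exists [:: i]; rewrite sE; congr tperm.
    by apply: val_inj; rewrite /= yE addn1.
  have [|w wE] := IHd x' y; first by rewrite yE /= /bump /= add1n addSnnS.
  exists ([:: i] ++ w ++ [:: i]); rewrite !catP sE wE.
  have x'y : x' != y.
    rewrite -val_eqE /= yE /bump /= add1n -addSnnS.
    by rewrite -[X in X != _]addn0 eqn_add2l.
  have xy : x != y by rewrite -val_eqE /= yE -[X in X != _]addn0 eqn_add2l.
  have -> : (tperm x x' * (tperm x' y * tperm x x') = tperm x' y ^ tperm x x')%g.
    by rewrite conjgE tpermV.
  by rewrite tpermJ tpermR tpermD.
have tpW (x y : 'I_n.+1) : exists w, word_perm w = tperm x y.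
  have [lexy|/ltnW leyx] := leqP x y.
    by apply: (tpP (y - x)%N); rewrite subnKC.
  by rewrite tpermC; apply: (tpP (x - y)%N); rewrite subnKC.
have [ts -> _] := prod_tpermP g.
elim: ts => [|t ts [w wE]]; first by exists [::]; rewrite /word_perm !big_nil.
have [u uE] := tpW t.1 t.2.
by exists (u ++ w); rewrite catP uE wE big_cons.
Qed.

Lemma has_expr_ex (n : nat) (g : 'S_n.+1) : exists m, has_expr g m.
Proof.
have [w wE] := word_perm_surj g; exists (size w).
by apply/existsP; exists (in_tuple w); rewrite wE.
Qed.

Definition cox_length (n : nat) (g : 'S_n.+1) : nat := ex_minn (has_expr_ex g).

Definition reduced_expr (n : nat) (g : 'S_n.+1) (w : seq 'I_n) : Prop :=
  word_perm w = g /\ size w = cox_length g.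

Definition fully_commutative (n : nat) (g : 'S_n.+1) : Prop :=
  forall u v : seq 'I_n,
    reduced_expr g u -> reduced_expr g v -> comm_equiv u v.

(* power series in x over Q((q)) *)
Definition A_series : fps laurent :=
  Fps (fun n => \sum_(g : 'S_n.+1 | `[< fully_commutative g >])
                  q ^+ cox_length g).

(* For n = 0 both conditions are vacuous and the empty word is the only word,
   so the constant term is 1. *)
Definition Ba_series : fps laurent :=
  Fps (fun n => laurent_of_fps (Fps (fun m =>
    #|[set H in heaps n m | alternating H && last_column_le1 H]|%:R))).

Definition L_series : fps laurent :=
  Fps (fun n => if n == 0%N then 0 else laurent_of_fps (Fps (fun m =>
    #|[set H in heaps n m | alternating H]|%:R))).

(* the q-Pochhammer symbol (a; q)_n *)
Definition qpoch (a : laurent) (n : nat) : laurent :=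
  \prod_(i < n) (1 - a * q ^+ i).

Definition N_series : fps laurent :=
  Fps (fun k => if k == 0%N then 0 else
    q ^- 'C(k, 2) * (qpoch (- q) k.-1 ^+ 2 / (1 - q ^+ k))).

Definition S_series : fps laurent :=
  Fps (fun k => if k == 0%N then 0 else
    q ^- 'C(k.+1, 2) * qpoch (- q) k.-1 * qpoch (- q) k).

(* Main.v *)
Require Import Defs.
From mathcomp Require Import all_boot all_order all_fingroup all_algebra.
From mathcomp Require Import boolp zify ring.
From Stdlib Require Import Relation_Operators.

Set Implicit Arguments.
Unset Strict Implicit.
Unset Printing Implicit Defensive.

Import GRing.Theory.

(** A commutation class is determined by its projections on the pairs of
    letters {i, i+1}. For an alternating heap these projections amount to the
    numbers of points of the columns, which change by at most 1 from one column
    to the next, and to a choice of the lower column at each step between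
    columns with equally many (and at least one) points. Hence, if U_n(h)
    counts by size the alternating heaps over n columns with h points in the
    last one, U_{n+1}(h) = q^h (U_n(h-1) + c_h U_n(h) + U_n(h+1)) with c_0 = 1
    and c_h = 2 otherwise. For W_n(z) = sum_h U_n(h) z^h and y = qz this reads
    y W_{n+1}(z) = (1+y)^2 W_n(y) - (1+y) U_n(0). Iterating from z = 1 down to
    one column produces the coefficients of S, and those of N or S(xq) in the
    initial term, according to whether the first column is free or has at most
    one point. Moreover U_{n+1}(0) = U_n(0) + U_n(1) counts the heaps over n
    columns with at most one point in the last one; reversing the path, it is
    also W_n(1) for the heaps with at most one point in the first column.

    In type A the fully commutative elements are the alternating heaps with at
    most one point in the first and in the last column. *)

(** * Commutation classes and projections *)

Definition far (i j : nat) := (i.+1 < j) || (j.+1 < i).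

Lemma comm_equiv_cat n (x y u v : seq 'I_n) :
  comm_equiv u v -> comm_equiv (x ++ u ++ y) (x ++ v ++ y).
Proof.
elim=> {u v} [_ _ [u v i j fij]|u|u v _ uv|u v w _ uv _ vw].
- rewrite -!catA /= !(catA x u); apply: rst_step; exact: CommStep.
- exact: rst_refl.
- exact: rst_sym.
- exact: rst_trans vw.
Qed.

Lemma comm_equiv_cons n a (u v : seq 'I_n) :
  comm_equiv u v -> comm_equiv (a :: u) (a :: v).
Proof. by move/(@comm_equiv_cat n [:: a] [::]); rewrite !cats0. Qed.

Lemma comm_equiv_swap n (a b : 'I_n) w :
  far a b -> comm_equiv [:: a, b & w] [:: b, a & w].
Proof. by move=> fab; apply: rst_step; apply: (@CommStep n [::]). Qed.

Lemma comm_equiv_move n (a : 'I_n) (p r : seq 'I_n) :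
  all (fun x : 'I_n => far a x) p -> comm_equiv (a :: p ++ r) (p ++ a :: r).
Proof.
elim: p => [|x p IHp] /=; first by move=> _; apply: rst_refl.
case/andP=> fax /IHp eqp; apply: rst_trans (comm_equiv_cons x eqp).
exact: comm_equiv_swap.
Qed.

Definition proj (i : nat) (w : seq nat) : seq nat :=
  [seq a <- w | (a == i) || (a == i.+1)].

Lemma proj_map n i (w : seq 'I_n) : proj i (map val w) =
  map val [seq a : 'I_n <- w | (a == i :> nat) || (a == i.+1 :> nat)].
Proof. by rewrite /proj filter_map. Qed.

Lemma comm_equiv_proj n (u v : seq 'I_n) i :
  comm_equiv u v -> proj i (map val u) = proj i (map val v).
Proof.
move=> uv; rewrite !proj_map; congr map.
apply: comm_equiv_filter uv => a b; lia.
Qed.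

Lemma first_occurrence (T : eqType) (a : T) (v : seq T) :
  a \in v -> exists p r, v = p ++ a :: r /\ a \notin p.
Proof.
elim: v => [//|b v IHv]; rewrite inE; case: eqVneq => [<- _|nab /= /IHv].
  by exists [::], v.
by case=> p [r [-> nap]]; exists (b :: p), r; rewrite inE negb_or nab.
Qed.

(** Induction on [u], with first letter [a]. A letter near [a] and ahead of its first occurrence in
    [v] would also come ahead of [a] in some projection, whereas the projections of [u] that keep
    [a] start with it. So that occurrence commutes to the front and cancels. *)
Lemma proj_comm_equiv n (u v : seq 'I_n) :
  (forall i, proj i (map val u) = proj i (map val v)) -> comm_equiv u v.
Proof.
elim: u v => [|a u IHu] v uv.
  case: v uv => [_|b v /(_ b)]; first exact: rst_refl.
  by rewrite /proj /= eqxx.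
have av : a \in v.
  rewrite -(mem_map val_inj).
  have := mem_head (val a) (proj a (map val u)).
  have /= := uv a; rewrite eqxx /= => ->.
  by rewrite mem_filter => /andP[].
have [p [r [vE nap]]] := first_occurrence av.
have fp : all (fun x : 'I_n => far a x) p.
  apply/allP => x xp; apply: contraT => nf.
  have nxa : val x != val a by apply: contraNneq nap => /val_inj <-.
  have [i xi ai] : exists2 i, (val x == i) || (val x == i.+1)
      & (val a == i) || (val a == i.+1).
    by exists (minn x a); rewrite /far /= in nf nxa *; lia.
  have /= := uv i; rewrite ai vE map_cat /proj filter_cat -!/(proj i _).
  have : val x \in proj i (map val p) by rewrite mem_filter xi map_f.
  case E: (proj i (map val p)) => [//|y s] _ [ay _].
  have : y \in proj i (map val p) by rewrite E mem_head.
  have <- : val a = y by [].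
  by rewrite mem_filter (mem_map val_inj) (negPf nap) andbF.
have eqv := comm_equiv_move r fp.
rewrite vE; apply: rst_trans (eqv).
apply: comm_equiv_cons; apply: IHu => i.
have := uv i; rewrite vE -(comm_equiv_proj i eqv) /=.
by case: ifP => _ // [].
Qed.

(** * Canonical words of alternating heaps *)

Definition alt_proj n (w : seq nat) : Prop :=
  forall i, i.+1 < n -> sorted (fun a b => a != b) (proj i w).

Lemma alternating_wordP n (w : seq 'I_n) :
  reflect (alt_proj n (map val w)) (alternating_word w).
Proof.
apply: (iffP forallP) => [altw i lin | altw i].
  have /= := altw (Ordinal (ltnW lin)); rewrite lin proj_map sorted_map.
  by apply: sub_sorted => a b /=; rewrite -val_eqE.
apply/implyP => lin; have := altw i lin; rewrite proj_map sorted_map.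
by apply: sub_sorted => a b /=; rewrite -val_eqE.
Qed.

Fixpoint altern (x y m : nat) : seq nat :=
  if m is m'.+1 then x :: altern y x m' else [::].

Lemma altern_sorted x y m :
  x != y -> sorted (fun a b => a != b) (altern x y m).
Proof.
elim: m x y => [//|[//|m] IHm] x y nxy; rewrite /= nxy.
by apply: (IHm y x); rewrite eq_sym.
Qed.

Lemma all_altern x y m : all (fun a => (a == x) || (a == y)) (altern x y m).
Proof.
elim: m x y => //= m IHm x y; rewrite eqxx /=.
by rewrite (eq_all (a2 := fun a => (a == y) || (a == x))) // => a; rewrite orbC.
Qed.

Lemma count_altern x y m : x != y ->
  (count_mem x (altern x y m) = uphalf m) * (count_mem y (altern x y m) = m./2).
Proof.
elim: m x y => [//|m IHm] x y nxy /=.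
have nyx : y != x by rewrite eq_sym.
by rewrite !(IHm y x nyx) eqxx (negPf nxy) uphalf_half; split => //; lia.
Qed.

Lemma path_altern x y s : path (fun a b => a != b) y s ->
  all (fun a => (a == x) || (a == y)) s -> s = altern x y (size s).
Proof.
elim: s x y => [//|a s IHs] x y /= /andP[nya pas] /andP[].
rewrite (eq_sym a y) (negPf nya) orbF => /eqP eax alls; rewrite {}eax in nya pas *.
by congr cons; apply: IHs => //; apply: sub_all alls => b; rewrite orbC.
Qed.

Lemma sorted_altern x y s : sorted (fun a b => a != b) s ->
  all (fun a => (a == x) || (a == y)) s ->
  s = altern x y (size s) \/ s = altern y x (size s).
Proof.
case: s => [|a s] /=; first by left.
move=> pas /andP[/orP[]/eqP eax alls]; rewrite {}eax in pas *; [left|right];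
  congr cons; apply: path_altern => //; apply: sub_all alls => b //.
by rewrite orbC.
Qed.

(** The first letter determines an alternating word of given length; [undup] merges the two
    candidates when both are empty. *)
Definition altwords (t k h : nat) : seq (seq nat) :=
  undup [seq s <- [:: altern t t.+1 (k + h); altern t.+1 t (k + h)]
        | (count_mem t s == k) && (count_mem t.+1 s == h)].

Lemma mem_altwords t k h s : s \in altwords t k h <->
  [/\ sorted (fun a b => a != b) s, all (fun a => (a == t) || (a == t.+1)) s,
      count_mem t s = k & count_mem t.+1 s = h].
Proof.
have ntt : t != t.+1 by lia.
rewrite mem_undup mem_filter !inE; split.
  case/andP=> /andP[/eqP-> /eqP->] /orP[]/eqP->.
    by rewrite altern_sorted // all_altern.
  rewrite altern_sorted 1?eq_sym //; split=> //.
  by apply: sub_all (all_altern _ _ _) => a; rewrite orbC.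
case=> srt alls ck ch; rewrite ck ch !eqxx /=.
have <- : size s = k + h.
  rewrite -ck -ch -count_predUI [X in _ + X](@eq_count _ _ pred0) => [|a /=]; last lia.
  by rewrite count_pred0 addn0; apply/esym/eqP; rewrite -all_count.
by case: (sorted_altern srt alls) => sE; rewrite -{}sE eqxx ?orbT.
Qed.

(** Entry of the transfer matrix between adjacent columns; [(h != 0).+1] is the c_h above, two empty
    columns leaving no choice of the lower one. *)
Definition step_weight (k h : nat) : nat :=
  if k == h then (h != 0).+1 else (k == h.+1) + (h == k.+1).

Lemma step_weightC k h : step_weight k h = step_weight h k.
Proof. by rewrite /step_weight; case: (eqVneq k h) => [->|] //; lia. Qed.

Lemma size_altwords t k h : size (altwords t k h) = step_weight k h.
Proof.
have ntt : t != t.+1 by lia.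
have nts : t.+1 != t by lia.
rewrite /altwords /= !(count_altern _ ntt) !(count_altern _ nts) /step_weight.
case: (eqVneq k h) => [->|nkh].
  have -> : uphalf (h + h) == h by lia.
  have -> : (h + h)./2 == h by lia.
  case: h => [|h] //=; rewrite inE.
  by rewrite eqseq_cons (negPf ntt).
case: ifP; case: ifP => /=; lia.
Qed.

(* Inserts the letters t + 1 of s into w so that the projection on {t, t+1}
   becomes s; meaningful only when w and s have equally many letters t. *)
Fixpoint mrg (t : nat) (w s : seq nat) : seq nat :=
  if w is a :: w' then
    if a == t then
      take (index t s) s ++ t :: mrg t w' (drop (index t s).+1 s)
    else a :: mrg t w' s
  else s.

(** Each [t] of [w] is matched with the next [t] of [s], the letters [t.+1] before the latter going
    in just ahead of it. The two filters thus invert the merge. *)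
Lemma mrgP t w s : all (fun a => a <= t) w ->
  all (fun a => (a == t) || (a == t.+1)) s -> count_mem t s = count_mem t w ->
  [seq a <- mrg t w s | a <= t] = w /\ proj t (mrg t w s) = s.
Proof.
elim: w s => [|a w IHw] s /= => [_ alls c0|/andP[lat allw] alls].
  split; last by apply/all_filterP.
  apply/eqP; rewrite -(negbK (_ == _)) -has_filter -all_predC.
  have : t \notin s by rewrite -has_pred1 has_count c0.
  move/memPn => nts; apply/allP => b bs; have := allP alls b bs.
  by have := nts b bs => /=; lia.
case: eqVneq => [eat|nat] cE /=.
  have ts : t \in s by rewrite -has_pred1 has_count cE.
  have [p [r [sE ntp]]] := first_occurrence ts.
  have ip : index t s = size p by rewrite sE index_cat (negPf ntp) /= eqxx addn0.
  rewrite ip sE take_size_cat // drop_cat ltnNge leqnSn /= subSnn drop1 /=.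
  move: alls cE; rewrite sE all_cat count_cat /= !eqxx (count_memPn ntp) /=.
  rewrite !add0n => /andP[allp allr] /eqP; rewrite eqSS => /eqP cr.
  have [IH1 IH2] := IHw r allw allr cr.
  rewrite /proj !filter_cat /= leqnn eqxx IH1 -/(proj t (mrg t w r)) IH2 eat.
  split; last by congr (_ ++ _); apply/all_filterP.
  rewrite -[RHS]cat0s; congr (_ ++ _).
  apply/eqP; rewrite -(negbK (_ == _)) -has_filter -all_predC.
  move/memPn: ntp => ntp; apply/allP => b bp; have := allP allp b bp.
  by have := ntp b bp => /=; lia.
have [IH1 IH2] := IHw s allw alls cE.
rewrite lat IH1 /proj /= -/(proj t _) IH2 (negPf nat) /=.
by have -> : (a == t.+1) = false by lia.
Qed.

Lemma mem_mrg t w s a : a \in mrg t w s -> (a \in w) || (a \in s).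
Proof.
elim: w s => [//|b w IHw] s /=; case: eqP => [->|_]; last first.
  by rewrite !inE; case: eqP => //= _; apply: IHw.
rewrite mem_cat inE => /orP[/mem_take->|]; first by rewrite orbT.
rewrite inE; case: eqP => //= _ /IHw/orP[->//|/mem_drop->]; exact: orbT.
Qed.

Lemma count_proj i a w : (a == i) || (a == i.+1) ->
  count_mem a (proj i w) = count_mem a w.
Proof.
move=> ai; rewrite count_filter; apply: eq_count => b /=.
by case: eqVneq => [->|].
Qed.

Lemma proj_filter_leq t i w : i < t -> proj i [seq a <- w | a <= t] = proj i w.
Proof.
by move=> lit; rewrite /proj -filter_predI; apply: eq_filter => b /=; lia.
Qed.

Lemma count_filter_leq t a w : a <= t ->
  count_mem a [seq b <- w | b <= t] = count_mem a w.
Proof. by move=> lat; rewrite count_filter; apply: eq_count => b /=; lia. Qed.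

Lemma proj_top t w : all (fun a => a <= t) w ->
  proj t w = nseq (count_mem t w) t.
Proof.
move=> allw; rewrite -size_filter.
have -> : proj t w = filter (pred1 t) w.
  by apply: eq_in_filter => b /(allP allw) /=; lia.
by apply/all_pred1P; apply: filter_all.
Qed.

Lemma proj_above t i w : all (fun a => a <= t) w -> t < i -> proj i w = [::].
Proof.
move=> allw lti; rewrite /proj (@eq_in_filter _ _ pred0) ?filter_pred0 //.
by move=> b /(allP allw) /=; lia.
Qed.

Lemma all_mrg t w s : all (fun a => a <= t) w ->
  all (fun a => (a == t) || (a == t.+1)) s ->
  all (fun a => a <= t.+1) (mrg t w s).
Proof.
move=> allw alls; apply/allP => a /mem_mrg/orP[/(allP allw)|/(allP alls)]; lia.
Qed.

Lemma size_mrg t w s : all (fun a => a <= t) w ->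
  all (fun a => (a == t) || (a == t.+1)) s -> count_mem t s = count_mem t w ->
  size (mrg t w s) = size w + count_mem t.+1 s.
Proof.
move=> allw alls cE; have [H1 H2] := mrgP allw alls cE.
rewrite -(count_predC (fun a => a <= t)) -size_filter H1; congr (_ + _).
rewrite -[in RHS]H2 count_proj ?eqxx ?orbT //; apply: eq_in_count => b.
by move/(allP (all_mrg allw alls)) => /=; lia.
Qed.

(* One representative of each alternating heap over t + 1 columns whose first
   column has a number of points satisfying P and whose last has h points. *)
Fixpoint heap_words (P : pred nat) (t h : nat) : seq (seq nat) :=
  if t is t'.+1 then
    [seq mrg t' p.1 p.2 | k <- iota 0 h.+2,
       p <- [seq (w, s) | w <- heap_words P t' k, s <- altwords t' k h]]
  else if P h then [:: nseq h 0] else [::].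

Definition heap_spec (P : pred nat) (t h : nat) (w : seq nat) : Prop :=
  [/\ all (fun a => a <= t) w, alt_proj t.+1 w, P (count_mem 0 w)
    & count_mem t w = h].

Lemma heap_wordsSP P t h v : reflect
  (exists k w s, [/\ k < h.+2, w \in heap_words P t k, s \in altwords t k h
     & v = mrg t w s]) (v \in heap_words P t.+1 h).
Proof.
apply: (iffP allpairsPdep) => [[k [_ [kh /allpairsP[[w s] /= [wE sE ->]] ->]]]
                              |[k [w [s [kh wE sE ->]]]]].
  by exists k, w, s; rewrite mem_iota in kh.
by exists k, (w, s); rewrite mem_iota; split=> //; apply/allpairsP; exists (w, s).
Qed.

Lemma heap_words_sound P t h w : w \in heap_words P t h -> heap_spec P t h w.
Proof.
elim: t h w => [|t IHt] h v /=.
  case: ifP => // Ph; rewrite inE => /eqP->; split.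
  - by rewrite all_nseq orbT.
  - by case.
  - by rewrite count_nseq /= mul1n.
  - by rewrite count_nseq /= mul1n.
case/heap_wordsSP=> k [w [s [_ /IHt[allw altw Pw cw]]]].
case/mem_altwords=> srt alls cs ch ->.
have cE : count_mem t s = count_mem t w by rewrite cs cw.
have [H1 H2] := mrgP allw alls cE; split.
- exact: all_mrg.
- move=> i; rewrite !ltnS leq_eqVlt => /predU1P[->|lit]; first by rewrite H2.
  by rewrite -(proj_filter_leq _ lit) H1; apply: altw.
- by rewrite -(count_filter_leq _ (leq0n t)) H1.
- by rewrite -(@count_proj t) ?eqxx ?orbT // H2.
Qed.

Lemma altwords_gap t s k h : s \in altwords t k h -> k < h.+2.
Proof.
move=> sE; have : 0 < size (altwords t k h) by case: (altwords _ _ _) sE.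
by rewrite size_altwords /step_weight; case: eqVneq => [->|]; lia.
Qed.

(** Restrict [v] to the letters up to [t], represent the result by induction, and merge [proj t v]
    back in. Only the projections are recovered, as the canonical word is merely equivalent to
    [v]. *)
Lemma heap_words_complete P t h v : heap_spec P t h v ->
  exists2 w, w \in heap_words P t h & forall i, proj i w = proj i v.
Proof.
elim: t h v => [|t IHt] h v [allv altv Pv cv].
  rewrite /= cv in Pv *; rewrite Pv; exists (nseq h 0); first exact: mem_head.
  have <- : v = nseq h 0; last by [].
  rewrite -cv -size_filter.
  have /all_filterP -> : all (pred1 0) v by apply: sub_all allv => b /=; lia.
  by apply/all_pred1P; apply: sub_all allv => b /=; lia.
have [|w wE pw] := IHt (count_mem t v) [seq a <- v | a <= t].
  split; first exact: filter_all.
  - by move=> i lit; rewrite proj_filter_leq //; apply: altv; apply: ltnW.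
  - by rewrite count_filter_leq.
  - by rewrite count_filter_leq.
have sE : proj t v \in altwords t (count_mem t v) h.
  apply/mem_altwords; split; [exact: altv | exact: filter_all | |].
    by rewrite count_proj ?eqxx.
  by rewrite count_proj ?eqxx ?orbT.
have [allw _ _ cw] := heap_words_sound wE.
have /mem_altwords[_ alls cs _] := sE.
have cE : count_mem t (proj t v) = count_mem t w by rewrite cs cw.
have [H1 H2] := mrgP allw alls cE.
exists (mrg t w (proj t v)) => [|i].
  apply/heap_wordsSP; exists (count_mem t v), w, (proj t v).
  by rewrite (altwords_gap sE).
case: (ltngtP i t) => [lit|lti|-> //].
  by rewrite -(proj_filter_leq _ lit) H1 pw proj_filter_leq.
have allm := all_mrg allw alls.
move: lti; rewrite leq_eqVlt => /predU1P[<-|lti]; last first.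
  by rewrite !(@proj_above t.+1 i) ?lti.
rewrite !(@proj_top t.+1) //; congr nseq.
by rewrite -(@count_proj t) ?eqxx ?orbT // H2 count_proj ?eqxx ?orbT.
Qed.

(** The projection at [t] of a merged word is its factor [s]; the lower projections, together with
    the number of letters [t], determine the other factor by induction. *)
Lemma heap_words_proj_inj P t h w w' :
  w \in heap_words P t h -> w' \in heap_words P t h ->
  (forall i, proj i w = proj i w') -> w = w'.
Proof.
elim: t h w w' => [|t IHt] h v v' /=.
  by case: ifP => // _; rewrite !inE => /eqP-> /eqP->.
case/heap_wordsSP=> k [w [s [_ wE /mem_altwords[srt alls cs ch] ->]]].
case/heap_wordsSP=> k' [w' [s' [_ wE' /mem_altwords[srt' alls' cs' ch'] ->]]].
have [allw altw Pw cw] := heap_words_sound wE.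
have [allw' altw' Pw' cw'] := heap_words_sound wE'.
have [|H1 H2] := mrgP allw alls; first by rewrite cs cw.
have [|H1' H2'] := mrgP allw' alls'; first by rewrite cs' cw'.
move=> eqp; have eqs : s = s' by rewrite -H2 -H2'.
have eqk : k = k' by rewrite -cs -cs' eqs.
rewrite -eqk in wE' cw'; rewrite (IHt k w w') ?eqs // => i.
case: (ltngtP i t) => [lit|lti|->].
- by rewrite -H1 -H1' !proj_filter_leq.
- by rewrite !(@proj_above t i).
- by rewrite !proj_top // cw cw'.
Qed.

Lemma heap_words_uniq P t h : uniq (heap_words P t h).
Proof.
elim: t h => [|t IHt] h; first by rewrite /=; case: ifP.
pose f (_ : nat) (p : seq nat * seq nat) := mrg t p.1 p.2.
apply: (@allpairs_uniq_dep _ (fun=> _) _ f (iota 0 h.+2)).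
- exact: iota_uniq.
- move=> k _; apply: allpairs_uniq; [exact: IHt | exact: undup_uniq |].
  by move=> [a b] [c d].
move=> x x' xin x'in.
case/allpairsPdep: xin => k [y [_ /allpairsP[[w s] /= [wE sE eqy]] eqx]].
case/allpairsPdep: x'in => [k' [y' [_ /allpairsP[[w' s'] /= [wE' sE' eqy']] eqx']]].
rewrite {}eqx {}eqx' {}eqy {}eqy' /f /= => eqm {x x' y y'}.
have [allw _ _ cw] := heap_words_sound wE.
have [allw' _ _ cw'] := heap_words_sound wE'.
case/mem_altwords: sE => _ alls cs _; case/mem_altwords: sE' => _ alls' cs' _.
have [|H1 H2] := mrgP allw alls; first by rewrite cs cw.
have [|H1' H2'] := mrgP allw' alls'; first by rewrite cs' cw'.
have eqw : w = w' by rewrite -H1 -H1' eqm.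
have eqs : s = s' by rewrite -H2 -H2' eqm.
have <- : k = k' by rewrite -cw -cw' eqw.
by rewrite eqw eqs.
Qed.

(** * Transversals of commutation classes and the count of heaps *)

Definition rep_system n m (Q : pred (seq 'I_n)) (l : seq (seq 'I_n)) : Prop :=
  [/\ uniq l, {in l, forall w, Q w /\ size w = m},
      forall v, Q v -> size v = m -> exists2 w, w \in l & comm_equiv w v
    & {in l &, forall u v, comm_equiv u v -> u = v}].

Lemma card_heaps n m (Q : pred (seq 'I_n)) l : rep_system m Q l ->
  #|[set H in heaps n m | [exists w in H, Q (tval w)]]| = size l.
Proof.
case=> ul lQ Ql injl.
pose cls (w : seq 'I_n) := [set u : m.-tuple 'I_n | `[< comm_equiv w u >]].
have mem_cls (w : m.-tuple 'I_n) : w \in cls w.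
  by rewrite inE; apply/asboolP; apply: rst_refl.
have eq_cls u v : comm_equiv u v -> cls u = cls v.
  move=> uv; apply/setP => x; rewrite !inE; apply/asboolP/asboolP.
    by apply: rst_trans; apply: rst_sym.
  exact: rst_trans.
have cls_heap (w : m.-tuple 'I_n) : cls w \in heaps n m.
  by apply/imsetP; exists w => //; apply/setP => x; rewrite !inE.
rewrite -(size_map cls l) -(card_uniqP _); last first.
  rewrite map_inj_in_uniq // => u v ul' vl eqc; apply: injl => //.
  have [_ sv] := lQ v vl.
  have /= := mem_cls (Tuple (introT eqP sv)).
  by rewrite -eqc inE => /asboolP.
apply: eq_card => H; rewrite inE; apply/andP/mapP.
  case=> HH /existsP[v /andP[vH Qv]].
  have [w wl wv] := Ql v Qv (size_tuple v); exists w => //.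
  apply/setP => x; rewrite inE; apply/idP/asboolP => [xH|wx].
    exact: rst_trans wv (comm_equiv_heap HH vH xH).
  case/imsetP: HH vH => u _ ->; rewrite !inE /= => /asboolP uv.
  apply/asboolP; apply: rst_trans wx; apply: rst_trans uv _; exact: rst_sym.
case=> w wl ->; have [Qw sw] := lQ w wl.
split; first exact: (cls_heap (Tuple (introT eqP sw))).
apply/existsP; exists (Tuple (introT eqP sw)); rewrite Qw andbT.
exact: (mem_cls (Tuple (introT eqP sw))).
Qed.

Definition heap_pred (P P' : pred nat) n (w : seq 'I_n) : bool :=
  [&& alternating_word w, P (count (fun a : 'I_n => a == 0 :> nat) w)
    & P' (count (fun a : 'I_n => a.+1 == n) w)].

Definition heap_list (P P' : pred nat) t m : seq (seq 'I_t.+1) :=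
  [seq map inord w
  | w <- [seq w <- flatten [seq heap_words P t h | h <- iota 0 m.+1 & P' h]
         | size w == m]].

Lemma size_heap_list P P' t m : size (heap_list P P' t m) =
  \sum_(h < m.+1 | P' h) count (fun w => size w == m) (heap_words P t h).
Proof.
rewrite size_map size_filter count_flatten -map_comp sumnE big_map big_filter.
by rewrite -[iota 0 _]/(index_iota 0 m.+1) big_mkord.
Qed.

Lemma heap_list_rep P P' t m :
  rep_system m (heap_pred P P' (n := t.+1)) (heap_list P P' t m).
Proof.
rewrite /heap_list; set L := [seq w <- flatten _ | _].
have LE w : w \in L <-> [/\ size w = m, P' (count_mem t w)
    & w \in heap_words P t (count_mem t w)].
  rewrite mem_filter; split.
    case/andP=> /eqP sw /flatten_mapP[h]; rewrite mem_filter => /andP[Ph _] wh.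
    by have [_ _ _ ->] := heap_words_sound wh.
  case=> sw P'w wE; rewrite sw eqxx; apply/flatten_mapP.
  exists (count_mem t w) => //; rewrite mem_filter P'w mem_iota /= ltnS -sw.
  exact: count_size.
have valW w h : w \in heap_words P t h ->
    map val (map inord w : seq 'I_t.+1) = w.
  case/heap_words_sound=> allw _ _ _; rewrite -map_comp -[RHS]map_id.
  by apply/eq_in_map => a /(allP allw) lat; rewrite /= inordK.
have valL w : w \in L -> map val (map inord w : seq 'I_t.+1) = w.
  by case/LE=> _ _ /valW.
have cnt (w : seq 'I_t.+1) :
    (count (fun a : 'I_t.+1 => a == 0 :> nat) w = count_mem 0 (map val w)) *
    (count (fun a : 'I_t.+1 => a.+1 == t.+1) w = count_mem t (map val w)).
  by rewrite !count_map; split; apply: eq_count => a /=; lia.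
split.
- rewrite map_inj_in_uniq => [|u v uL vL]; last first.
    by move/(congr1 (map val)); rewrite !valL.
  apply/filter_uniq.
  have : uniq [seq h <- iota 0 m.+1 | P' h] by apply/filter_uniq/iota_uniq.
  elim: [seq h <- _ | _] => [//|h s IHs] /= /andP[hs us].
  rewrite cat_uniq heap_words_uniq IHs // andbT; apply/hasPn => w.
  case/flatten_mapP=> h' h's /heap_words_sound[_ _ _ cw]; apply/negP.
  by case/heap_words_sound=> _ _ _ cw'; case/negP: hs; rewrite -cw' cw.
- move=> _ /mapP[w wL ->]; have vw := valL w wL.
  case/LE: (wL) => sw P'w /heap_words_sound[_ altw Pw _]; split.
    rewrite /heap_pred !cnt vw Pw P'w !andbT.
    by apply/alternating_wordP; rewrite vw.
  by rewrite size_map.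
- move=> v /and3P[/alternating_wordP altv]; rewrite !cnt => Pv P'v sv.
  have [|w wE pw] := @heap_words_complete P t (count_mem t (map val v)) (map val v).
    by split=> //; apply/allP => _ /mapP[a _ ->]; rewrite -ltnS ltn_ord.
  have cw : count_mem t w = count_mem t (map val v).
    by rewrite -(@count_proj t) ?eqxx // pw count_proj ?eqxx.
  have eqwv : comm_equiv (map inord w) v.
    by apply: proj_comm_equiv => i; rewrite (valW _ _ wE).
  have sw : size w = m.
    by have := comm_equiv_count predT eqwv; rewrite !count_predT size_map sv.
  have wL : w \in L by apply/LE; rewrite cw; split.
  by exists (map inord w); first exact: map_f.
- move=> _ _ /mapP[u uL ->] /mapP[v vL ->] /(comm_equiv_proj (n := t.+1)) eqp.
  case/LE: (uL) => _ _ uE; case/LE: (vL) => _ _ vE.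
  have {}eqp i : proj i u = proj i v by have := eqp i; rewrite !valL.
  congr map; apply: heap_words_proj_inj uE _ (eqp).
  by rewrite -(@count_proj t) ?eqxx // eqp count_proj ?eqxx.
Qed.

(** * Coxeter length of the symmetric group *)

Definition swapn (i k : nat) := if k == i then i.+1 else if k == i.+1 then i else k.

Lemma adj_tpermE n (i : 'I_n) (x : 'I_n.+1) : adj_tperm i x = swapn i x :> nat.
Proof.
rewrite /adj_tperm /swapn; case: tpermP => [->|->|/eqP xi /eqP xj] /=.
- by rewrite eqxx.
- by rewrite /bump /= add1n eqxx; case: eqP => //; lia.
- rewrite -!val_eqE /= /bump /= add1n in xi xj.
  by rewrite (negPf xi) (negPf xj).
Qed.

Definition pval n (g : 'S_n.+1) (k : nat) : nat := g (inord k).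

Lemma pval_adjM n (i : 'I_n) (g : 'S_n.+1) k : k <= n ->
  pval (adj_tperm i * g)%g k = pval g (swapn i k).
Proof.
move=> lekn; rewrite /pval permM; congr (nat_of_ord (g _)); apply: val_inj => /=.
rewrite adj_tpermE inordK // inordK // /swapn.
by have := ltn_ord i; case: eqP => // _; case: eqP; lia.
Qed.

(** Permutations compose from left to right, so left multiplication by [adj_tperm i] exchanges the
    values at the positions i and i + 1: these descents govern the first letter of a reduced
    word. *)
Definition descent n (g : 'S_n.+1) (i : nat) : bool := pval g i.+1 < pval g i.

Lemma descent_adjM n (i : 'I_n) (g : 'S_n.+1) (j : 'I_n) : descent (adj_tperm i * g)%g j =
  (pval g (swapn i j.+1) < pval g (swapn i j)).
Proof. by rewrite /descent !pval_adjM //; have := ltn_ord j; lia. Qed.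

Lemma pvalS_neq n (g : 'S_n.+1) i : i < n -> pval g i != pval g i.+1.
Proof.
move=> lin; apply/negP => /eqP/val_inj/perm_inj/(congr1 val) /=.
by rewrite !inordK; lia.
Qed.

Lemma descent_adjM_same n (i : 'I_n) (g : 'S_n.+1) :
  descent (adj_tperm i * g)%g i = ~~ descent g i.
Proof.
rewrite descent_adjM /swapn /descent !eqxx.
have -> : (i.+1 == i) = false by lia.
by have := pvalS_neq g (ltn_ord i); lia.
Qed.

Lemma descent_adjM_far n (i : 'I_n) (g : 'S_n.+1) (j : 'I_n) : far i j ->
  descent (adj_tperm i * g)%g j = descent g j.
Proof.
rewrite descent_adjM /swapn /far => fij.
have [-> -> -> ->] : [/\ (j == i :> nat) = false, (j == i.+1 :> nat) = false,
  (j.+1 == i :> nat) = false & (j.+1 == i.+1 :> nat) = false] by split; lia.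
by [].
Qed.

(** Both descents make the values at three consecutive positions decreasing, so [i], [j], [i] can be
    stripped off one after the other, each as a descent. *)
Lemma descent_adjM_near n (i j : 'I_n) (g : 'S_n.+1) : i != j -> ~~ far i j ->
  descent g i -> descent g j ->
  descent (adj_tperm i * g)%g j /\
  descent (adj_tperm j * (adj_tperm i * g))%g i.
Proof.
rewrite -val_eqE /= => nij nf di dj; have lin := ltn_ord i; have ljn := ltn_ord j.
have [|] : (j = i.+1 :> nat) \/ (i = j.+1 :> nat) by rewrite /far in nf; lia.
all: move=> eij; rewrite !descent_adjM !pval_adjM; try by rewrite /swapn; lia.
all: rewrite /descent in di dj.
all: rewrite eij in di dj *; rewrite /swapn ?eqxx.
all: repeat case: eqP => //; lia.
Qed.

Definition invset n (g : 'S_n.+1) : {set 'I_n.+1 * 'I_n.+1} :=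
  [set p : 'I_n.+1 * 'I_n.+1 | (p.1 < p.2) && (g p.2 < g p.1)].

Definition invn n (g : 'S_n.+1) : nat := #|invset g|.

(** Exchanging the positions i and i + 1 matches the inversions of the two permutations, except for
    the pair of these positions itself. The additive form avoids truncated subtraction. *)
Lemma invn_adjM n (i : 'I_n) (g : 'S_n.+1) :
  invn (adj_tperm i * g)%g + descent g i = invn g + ~~ descent g i.
Proof.
have lin := ltn_ord i.
pose p : 'I_n.+1 * 'I_n.+1 := (inord i, inord i.+1).
have inp h : (p \in invset h) = descent h i.
  by rewrite inE /= !inordK ?ltnS ?leqnn //; apply: ltnW.
rewrite /invn (cardsD1 p) [in RHS](cardsD1 p) !inp descent_adjM_same.
suff -> : #|invset (adj_tperm i * g) :\ p|%g = #|invset g :\ p|.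
  by rewrite addnC -addnA; congr (_ + _); apply: addnC.
pose f (x : 'I_n.+1 * 'I_n.+1) := (adj_tperm i x.1, adj_tperm i x.2).
have injf : injective f by move=> [x y] [z u] [/perm_inj-> /perm_inj->].
rewrite -(card_preimset _ injf); apply: eq_card => -[x y].
rewrite !inE !permM /= /f /= !andbA; congr (_ && _); last by rewrite !tpermK.
rewrite /p !xpair_eqE -!val_eqE /= !adj_tpermE !inordK ?ltnS //; last by apply: ltnW.
by rewrite /swapn; repeat case: eqP => //=; lia.
Qed.

Lemma word_perm_cons n a (w : seq 'I_n) :
  word_perm (a :: w) = (adj_tperm a * word_perm w)%g.
Proof. by rewrite /word_perm big_cons. Qed.

Lemma word_perm_cat n (u v : seq 'I_n) :
  word_perm (u ++ v) = (word_perm u * word_perm v)%g.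
Proof. by rewrite /word_perm big_cat. Qed.

Lemma adj_tpermK n (a : 'I_n) (g : 'S_n.+1) : (adj_tperm a * (adj_tperm a * g) = g)%g.
Proof. by rewrite mulgA tperm2 mul1g. Qed.

(** The values grow by at least 1 per position: counted from position 0 this gives x <= g x, counted
    up to position n it gives g x <= x. *)
Lemma no_descent_id n (g : 'S_n.+1) :
  (forall i : 'I_n, ~~ descent g i) -> g = 1%g.
Proof.
move=> nd.
have step k : k < n -> pval g k < pval g k.+1.
  move=> lkn; have := nd (Ordinal lkn).
  by rewrite /descent /=; have := pvalS_neq g lkn; lia.
have grow k d : k + d <= n -> pval g k + d <= pval g (k + d).
  elim: d => [|d IHd] lkd; first by rewrite !addn0.
  by have := step (k + d); rewrite !addnS in lkd *; have := IHd; lia.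
apply/permP => x; rewrite perm1; apply: val_inj => /=.
have xE : pval g x = g x by rewrite /pval inord_val.
have lxn : x <= n by rewrite -ltnS.
have h1 : x <= g x by have := grow 0 x; rewrite add0n xE; lia.
have lgn : pval g n <= n by rewrite -ltnS ltn_ord.
by have := grow x (n - x); rewrite subnKC // xE; lia.
Qed.

Lemma word_of_invn n (g : 'S_n.+1) :
  exists w, word_perm w = g /\ size w = invn g.
Proof.
have [m] := ubnP (invn g); elim: m g => [//|m IHm] g lgm.
have [/existsP[i di]|nd] := boolP [exists i : 'I_n, descent g i].
  have := invn_adjM i g; rewrite di /= => e.
  have [|w [wE sw]] := IHm (adj_tperm i * g)%g; first lia.
  exists (i :: w); rewrite word_perm_cons wE adj_tpermK; split => //=; lia.
have -> : g = 1%g.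
  by apply: no_descent_id => i; move: nd; rewrite negb_exists => /forallP.
exists [::]; rewrite /word_perm big_nil; split=> //.
apply/esym/eqP; rewrite cards_eq0; apply/eqP/setP => p.
by rewrite !inE !perm1; lia.
Qed.

Lemma invn_word n (w : seq 'I_n) : invn (word_perm w) <= size w.
Proof.
elim: w => [|a w IHw]; last first.
  by rewrite word_perm_cons /=; have := invn_adjM a (word_perm w); lia.
rewrite /word_perm big_nil leqn0 cards_eq0; apply/eqP/setP => p.
by rewrite !inE !perm1; lia.
Qed.

Lemma cox_lengthE n (g : 'S_n.+1) : cox_length g = invn g.
Proof.
rewrite /cox_length; case: ex_minnP => m /existsP[w /eqP wE] minm.
apply/eqP; rewrite eqn_leq; apply/andP; split.
  have [u [uE su]] := word_of_invn g; apply: minm.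
  rewrite -su; apply/existsP; exists (in_tuple u).
  by rewrite uE.
by rewrite -wE -[leqRHS](size_tuple w); apply: invn_word.
Qed.

Definition reduced n (w : seq 'I_n) : Prop := size w = invn (word_perm w).

Lemma reduced_cons n a (w : seq 'I_n) : reduced (a :: w) <->
  reduced w /\ ~~ descent (word_perm w) a.
Proof.
rewrite /reduced word_perm_cons /=.
have := invn_adjM a (word_perm w); have := invn_word w.
by case: (descent _ _) => /=; split; try case; lia.
Qed.

Lemma reduced_descent n a (w : seq 'I_n) : reduced (a :: w) ->
  descent (word_perm (a :: w)) a.
Proof.
by rewrite word_perm_cons descent_adjM_same => /reduced_cons[].
Qed.

Lemma descent_word n (g : 'S_n.+1) (a : 'I_n) w : descent g a ->
  word_perm w = (adj_tperm a * g)%g -> reduced w ->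
  word_perm (a :: w) = g /\ reduced (a :: w).
Proof.
move=> da wE rw; rewrite word_perm_cons wE adj_tpermK; split=> //.
by apply/reduced_cons; rewrite wE descent_adjM_same da.
Qed.

Lemma adj_tperm_far n (a b : 'I_n) : far a b ->
  (adj_tperm a * adj_tperm b = adj_tperm b * adj_tperm a)%g.
Proof.
move=> fab; apply/permP => x; rewrite !permM; apply: val_inj.
rewrite /= !adj_tpermE /swapn /far in fab *.
by repeat case: eqP => //=; lia.
Qed.

Lemma adj_tperm_braid n (a b : 'I_n) : ~~ far a b ->
  (adj_tperm a * (adj_tperm b * adj_tperm a) =
   adj_tperm b * (adj_tperm a * adj_tperm b))%g.
Proof.
case: (eqVneq a b) => [->//|]; rewrite -val_eqE /= => nab fab.
apply/permP => x; rewrite !permM; apply: val_inj.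
rewrite /= !adj_tpermE /swapn /far in fab *.
by repeat case: eqP => //=; lia.
Qed.

Lemma comm_equiv_perm n (u v : seq 'I_n) :
  comm_equiv u v -> word_perm u = word_perm v.
Proof.
elim=> [_ _ [{}u {}v i j fij]|//|x y _ -> //|x y z _ -> _ -> //].
rewrite !word_perm_cat !word_perm_cons !mulgA -!(mulgA (word_perm u)).
by rewrite (adj_tperm_far fij).
Qed.

Lemma comm_equiv_size n (u v : seq 'I_n) : comm_equiv u v -> size u = size v.
Proof. by move/(comm_equiv_count predT); rewrite !count_predT. Qed.

(** * Fully commutative permutations *)

Definition fc_word n (w : seq 'I_n) : bool :=
  heap_pred (fun c => c <= 1) (fun c => c <= 1) w.

Lemma fc_word_equiv n (u v : seq 'I_n) :
  comm_equiv u v -> fc_word u -> fc_word v.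
Proof.
move=> uv; rewrite /fc_word /heap_pred (comm_equiv_alternating uv).
by rewrite !(comm_equiv_count _ uv).
Qed.

Lemma fc_word_behead n a (w : seq 'I_n) : fc_word (a :: w) -> fc_word w.
Proof.
case/and3P=> /alternating_wordP alt /= c0 cn; apply/and3P; split; [|lia..].
apply/alternating_wordP => i lin; have := alt i lin; rewrite /=.
by case: ifP => // _ /path_sorted.
Qed.

Lemma sorted_neq_dup (T : eqType) (p r : seq T) c :
  sorted (fun a b => a != b) (p ++ [:: c, c & r]) = false.
Proof. by case: p => [|x p] /=; rewrite ?cat_path /= eqxx ?andbF. Qed.

Lemma fc_word_square n a (w : seq 'I_n) : ~~ fc_word [:: a, a & w].
Proof.
apply/negP => /and3P[/alternating_wordP alt _ /=].
have [lan _|] := ltnP a.+1 n; last by have := ltn_ord a; lia.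
by have := alt _ lan; rewrite /= eqxx /= eqxx.
Qed.

(** Between the two letters [a] the neighbour of [a] other than [b] is missing; if there is no such
    neighbour, [a] is an end letter and the bound on its column fails. *)
Lemma fc_word_braid n (a b : 'I_n) w : a != b -> ~~ far a b ->
  ~~ fc_word [:: a, b, a & w].
Proof.
rewrite -val_eqE /= => nab nf; apply/negP => /and3P[/alternating_wordP alt /=].
have lan := ltn_ord a; have lbn := ltn_ord b.
have [eab|eab] : (b = a.+1 :> nat) \/ (a = b.+1 :> nat).
  by rewrite /far in nf; lia.
  have [->|a0] := eqVneq (nat_of_ord a) 0; first by lia.
  move=> _ _; have := alt a.-1; rewrite prednK ?lt0n // => /(_ lan).
  have ai : (val a == a.-1) || (val a == a.-1.+1) by rewrite /=; lia.
  have bi : (val b == a.-1) || (val b == a.-1.+1) = false by rewrite /=; lia.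
  by rewrite /= ai bi /= eqxx.
have [lan'|] := ltnP a.+1 n; last by lia.
move=> _ _; have := alt a lan'.
have bi : (val b == a) || (val b == a.+1) = false by rewrite /=; lia.
by rewrite /= bi eqxx /= eqxx.
Qed.

(* If reduced words a w and b v of g start with distinct letters, both are
   descents of g, so g also has a reduced word a b k (a and b commuting) or
   a b a k; the latter is impossible, w being equivalent to b a k by induction. *)
Lemma fc_word_reduced n (w : seq 'I_n) : fc_word w -> reduced w /\
  forall v, word_perm v = word_perm w -> reduced v -> comm_equiv w v.
Proof.
have [m] := ubnP (size w); elim: m w => [//|m IHm] [_ _|a w].
  have r0 : @reduced n [::] by have := @invn_word n [::]; rewrite /reduced /=; lia.
  split=> // v vE; rewrite /reduced vE -r0 => /size0nil ->; exact: rst_refl.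
rewrite ltnS /= => lwm gw; have gw' := fc_word_behead gw.
have [rw uw] := IHm w lwm gw'.
have rewr k : word_perm k = word_perm w -> reduced k ->
    comm_equiv (a :: w) (a :: k).
  by move=> kE rk; apply/comm_equiv_cons/uw.
(* If [a] were a descent of [w], then [w] would be equivalent to a reduced word [a :: k] by
   induction, and [a :: w] to a word starting with a square. *)
have ra : reduced (a :: w).
  apply/reduced_cons; split=> //; apply/negP => da.
  have [k [kE sk]] := word_of_invn (adj_tperm a * word_perm w)%g.
  have [|aE ak] := descent_word da kE; first by rewrite /reduced kE.
  have := fc_word_equiv (rewr _ aE ak) gw.
  by rewrite (negPf (fc_word_square _ _)).
split=> // v vE rv; set g := word_perm (a :: w) in vE.
have da : descent g a by apply: reduced_descent.
have sv : size v = (size w).+1 by rewrite rv vE -ra.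
case: v sv vE rv => [//|b v] sv vE rv.
have db : descent g b by rewrite -vE; apply: reduced_descent.
have [rv' _] := (reduced_cons b v).1 rv.
have gE : (adj_tperm a * g)%g = word_perm w.
  by rewrite /g word_perm_cons adj_tpermK.
case: (eqVneq a b) => [eab|nab].
  rewrite -eab in vE *; apply: comm_equiv_cons; apply: uw => //.
  by apply: (mulgI (adj_tperm a)); rewrite -!word_perm_cons.
have [fab|nfab] := boolP (far a b).
  have db' : descent (adj_tperm a * g)%g b by rewrite descent_adjM_far.
  have [k [kE sk]] := word_of_invn (adj_tperm b * (adj_tperm a * g))%g.
  have [|bE bk] := descent_word db' kE; first by rewrite /reduced kE.
  have e1 : comm_equiv (a :: w) [:: a, b & k] by apply: rewr; rewrite ?bE.
  have e2 : comm_equiv (a :: w) [:: b, a & k].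
    by apply: rst_trans (e1) _; apply: comm_equiv_swap.
  have gk := fc_word_behead (fc_word_equiv e2 gw).
  (* The word [a :: k] is as long as [w], so induction on the length covers it. *)
  have sk' : size (a :: k) < m.
    by have := comm_equiv_size e2 => /=; lia.
  have [_ uk] := IHm _ sk' gk.
  apply: rst_trans (e2) _; apply: comm_equiv_cons; apply: uk => //.
  apply: (mulgI (adj_tperm b)); rewrite -!word_perm_cons vE.
  exact: comm_equiv_perm e2.
have [d1 d2] := descent_adjM_near nab nfab da db.
have [k [kE sk]] := word_of_invn (adj_tperm a * (adj_tperm b * (adj_tperm a * g)))%g.
have [|aE ak] := descent_word d2 kE; first by rewrite /reduced kE.
have [bE bk] := descent_word d1 aE ak.
have e1 : comm_equiv (a :: w) [:: a, b, a & k] by apply: rewr; rewrite ?bE.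
by have := fc_word_equiv e1 gw; rewrite (negPf (fc_word_braid _ nab nfab)).
Qed.

Definition braid_free n (w : seq 'I_n) : Prop :=
  forall v, comm_equiv w v -> forall p r a,
    v <> p ++ [:: a, a & r] /\
    (forall b, a != b -> ~~ far a b -> v <> p ++ [:: a, b, a & r]).

Lemma braid_free_behead n a (w : seq 'I_n) : braid_free (a :: w) -> braid_free w.
Proof.
move=> bf v wv p r c; have [h1 h2] := bf _ (comm_equiv_cons a wv) (a :: p) r c.
by split=> [vE|b nab nf vE]; [apply: h1 | apply: (h2 b nab nf)]; rewrite vE.
Qed.

(** Put [a] in front of [w], which satisfies the conditions by induction. They can only fail if [a]
    recurs without both of its neighbours occurring before the recurrence. At most one letter near
    [a] then stands in between, and commutations produce a factor [a a] or a braid [a b a]. *)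
Lemma braid_free_fc_word n (w : seq 'I_n) : braid_free w -> fc_word w.
Proof.
elim: w => [_|a w IHw bf].
  by rewrite /fc_word /heap_pred /= !andbT; apply/alternating_wordP.
have gw := IHw (braid_free_behead bf).
have /and3P[/alternating_wordP alt c0 cn] := gw.
have lan := ltn_ord a.
have [aw|naw] := boolP (a \in w); last first.
  have nvw : val a \notin map val w by rewrite (mem_map val_inj).
  apply/and3P; split=> /=.
  - apply/alternating_wordP => i lin; have := alt i lin; rewrite /=.
    case: ifP => // _; case E: (proj i (map val w)) => [//|y s] /= ->.
    rewrite andbT; apply: contraNneq nvw => ay.
    have : y \in proj i (map val w) by rewrite E mem_head.
    by rewrite mem_filter => /andP[_]; have <- : val a = y by [].
  - case: (eqVneq (nat_of_ord a) 0) => [a0|_]; last exact: c0.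
    rewrite (@eq_count _ _ (pred1 a)) ?(count_memPn naw) // => x /=.
    by rewrite -val_eqE /= a0.
  - case: (eqVneq a.+1 n) => [an|_]; last exact: cn.
    rewrite (@eq_count _ _ (pred1 a)) ?(count_memPn naw) // => x /=.
    by rewrite -val_eqE /=; lia.
have [p [r [wE nap]]] := first_occurrence aw.
have [/andP[/hasP[x xp /eqP xE] /hasP[y yp /eqP yE]]|nboth] :=
    boolP (has (fun x : 'I_n => x == a.+1 :> nat) p &&
           has (fun x : 'I_n => a == x.+1 :> nat) p).
  have hd i z : z \in p -> (val z == i) || (val z == i.+1) ->
      (val a == i) || (val a == i.+1) -> i.+1 < n ->
      sorted (fun u v => u != v) (proj i (map val (a :: w))).
    move=> zp zi ai lin; have := alt i lin; rewrite /= ai.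
    have : val z \in proj i (map val p) by rewrite mem_filter zi map_f.
    rewrite wE map_cat /proj filter_cat -!/(proj i _).
    case E: (proj i (map val p)) => [//|u s] _ /= ->; rewrite andbT.
    have : u \in proj i (map val p) by rewrite E mem_head.
    rewrite mem_filter => /andP[_]; apply: contraTneq => <-.
    by rewrite (mem_map val_inj).
  have lxn := ltn_ord x.
  apply/and3P; split=> /=.
  - apply/alternating_wordP => i lin.
    have [ai|] := eqVneq (val a) i.
      by apply: (hd i x) => //=; rewrite -ai /= ?xE eqxx ?orbT.
    have [ai nai|nai' nai] := eqVneq (val a) i.+1.
      by apply: (hd i y) => //; rewrite ?ai ?eqxx ?orbT //=; rewrite /= in ai; lia.
    by rewrite /= (negPf nai) (negPf nai'); apply: alt.
  - have -> : (val a == 0) = false by rewrite /= yE.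
    exact: c0.
  - have -> : (a.+1 == n) = false by lia.
    exact: cn.
exfalso.
have near1 x y : x \in p -> y \in p -> ~~ far a x -> ~~ far a y -> x = y.
  move=> xp yp nx ny; apply: val_inj => /=.
  have nxa : val x != val a by apply: contraNneq nap => /val_inj <-.
  have nya : val y != val a by apply: contraNneq nap => /val_inj <-.
  apply: contraNeq nboth => nxy; rewrite /far /= in nx ny nxa nya nxy *.
  apply/andP; have [xa|xa] := eqVneq (nat_of_ord x) a.+1.
    by split; apply/hasP; [exists x | exists y] => //; lia.
  by split; apply/hasP; [exists y | exists x] => //; lia.
have [fp|/allPn[b bp nfb]] := boolP (all (fun x : 'I_n => far a x) p).
  have e1 : comm_equiv (a :: w) (p ++ [:: a, a & r]).
    by rewrite wE; apply: comm_equiv_move.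
  by have [h _] := bf _ e1 p r a; apply: h.
have nab : a != b by apply: contraNneq nap => ->.
have [p1 [p2 [pE nbp1]]] := first_occurrence bp.
(* Two occurrences of [b] ahead of the first [a] would yield consecutive letters [b] in the
   projection of [w] on the pair of [a] and [b]. *)
have nbp2 : b \notin p2.
  apply/negP => /first_occurrence [p3 [p4 [p2E nbp3]]].
  have nv : val a != val b by rewrite val_eqE.
  have := alt (minn a b); have lbn := ltn_ord b.
  have -> : (minn a b).+1 < n by rewrite /= in nv; rewrite /far in nfb; lia.
  move=> /(_ isT).
  have bi : (val b == minn a b) || (val b == (minn a b).+1).
    by rewrite /= in nv *; rewrite /far in nfb; lia.
  rewrite wE pE p2E !map_cat /= map_cat /proj !filter_cat /= bi filter_cat /= bi.
  rewrite (_ : [seq c <- map val p3 | _] = [::]) /=.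
    by rewrite -!catA /= sorted_neq_dup.
  apply/eqP; rewrite -(negbK (_ == _)) -has_filter; apply/hasPn => _ /mapP[x xp3 ->].
  have xp : x \in p by rewrite pE p2E !(mem_cat, inE) xp3 !orbT.
  apply/negP => xi; have nxa : val x != val a by apply: contraNneq nap => /val_inj <-.
  case/negP: nbp3; rewrite -(near1 x b) //.
  by rewrite /far in nfb *; rewrite /= in nv xi nxa *; lia.
have f1 : all (fun x : 'I_n => far a x) p1.
  apply/allP => x xp1; apply: contraNT nbp1 => nfx.
  by rewrite -(near1 x b) // pE mem_cat xp1.
have f2 : all (fun x : 'I_n => far a x) p2.
  apply/allP => x xp2; apply: contraNT nbp2 => nfx.
  by rewrite -(near1 x b) // pE mem_cat inE xp2 !orbT.
have e1 : comm_equiv (a :: w) (p1 ++ [:: a, b, a & p2 ++ r]).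
  rewrite wE pE -catA /=; apply: rst_trans (comm_equiv_move _ f1) _.
  have e2 := rst_sym _ _ _ _ (comm_equiv_move r f2).
  by have := comm_equiv_cat (p1 ++ [:: a; b]) [::] e2; rewrite !cats0 -!catA.
by have [_ h] := bf _ e1 p1 (p2 ++ r) a; apply: (h b nab nfb).
Qed.

(** A factor [a a] would cancel and shorten a reduced word; a factor [a b a] could be turned into
    [b a b], giving a reduced word of the same permutation with fewer letters [a], hence not
    equivalent. *)
Lemma fully_commutative_fc_word n (g : 'S_n.+1) (w : seq 'I_n) :
  fully_commutative g -> reduced_expr g w -> fc_word w.
Proof.
move=> fc [wg sw]; apply: braid_free_fc_word => v wv p r a.
have vg : word_perm v = g by rewrite -(comm_equiv_perm wv).
have sv : size v = cox_length g by rewrite -(comm_equiv_size wv).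
split=> [vE|b nab nf vE].
  have := invn_word (p ++ r); rewrite word_perm_cat.
  have -> : (word_perm p * word_perm r)%g = g.
    by rewrite -vg vE word_perm_cat !word_perm_cons adj_tpermK.
  by rewrite -cox_lengthE -sv vE !size_cat /=; lia.
have v'g : word_perm (p ++ [:: b, a, b & r]) = g.
  rewrite -vg vE !word_perm_cat !word_perm_cons; congr (_ * _)%g.
  by rewrite !mulgA; congr (_ * _)%g; rewrite -!mulgA (adj_tperm_braid nf).
have sv' : size (p ++ [:: b, a, b & r]) = cox_length g.
  by rewrite -sv vE !size_cat.
have := comm_equiv_count (pred1 a) (fc v _ (conj vg sv) (conj v'g sv')).
by rewrite vE !count_cat /= eqxx eq_sym (negPf nab); lia.
Qed.

(** By [fc_word_reduced], words satisfying [fc_word] are equivalent exactly when their permutations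
    agree, so [word_perm] carries the transversal bijectively onto the fully commutative
    permutations of length [m]. *)
Lemma card_fully_commutative n m l : rep_system m (@fc_word n) l ->
  #|[set g : 'S_n.+1 | `[< fully_commutative g >] && (cox_length g == m)]|
  = size l.
Proof.
case=> ul lQ Ql injl.
rewrite -(size_map (@word_perm n) l) -(card_uniqP _); last first.
  rewrite map_inj_in_uniq // => u v ul' vl eqp; apply: injl => //.
  have [[gu _] [gv _]] := (lQ u ul', lQ v vl).
  have [_ uu] := fc_word_reduced gu; have [rv _] := fc_word_reduced gv.
  by apply: uu.
apply: eq_card => g; rewrite inE; apply/andP/mapP.
  case=> /asboolP fc /eqP sg.
  have [w [wE sw]] := word_of_invn g; rewrite -cox_lengthE in sw.
  have gw := fully_commutative_fc_word fc (conj wE sw).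
  have [v vl vw] := Ql w gw (etrans sw sg); exists v => //.
  by rewrite -wE (comm_equiv_perm vw).
case=> w wl ->; have [gw sw] := lQ w wl.
have [rw uw] := fc_word_reduced gw.
split; last by rewrite cox_lengthE -rw sw.
apply/asboolP => u v [ug su] [vg sv]; rewrite !cox_lengthE in su sv.
apply: rst_trans (_ : comm_equiv w v).
  by apply: rst_sym; apply: uw => //; rewrite /reduced ug.
by apply: uw => //; rewrite /reduced vg.
Qed.

Local Open Scope ring_scope.

(** * Summable families of power series *)

Local Notation X := (fpsX rat).

Lemma coef_fps_sum (R : zmodType) I (r : seq I) (Q : pred I) (F : I -> fps R) m :
  (\sum_(i <- r | Q i) F i) m = \sum_(i <- r | Q i) F i m.
Proof. by apply: (big_morph (fun f : fps R => f m)). Qed.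

Lemma coef_fpsXM (R : comNzRingType) (f : fps R) m :
  (fpsX R * f) m = if m is m'.+1 then f m' else 0.
Proof.
rewrite coef_fpsM; case: m => [|m]; first by rewrite big_ord1 mul0r.
rewrite big_ord_recl mul0r add0r big_ord_recl mul1r big1 ?addr0 => [|i _].
  by rewrite /bump /= subSS subn0.
by rewrite mul0r.
Qed.

Lemma coef_fpsXnM (R : comNzRingType) (f : fps R) n m :
  (fpsX R ^+ n * f) m = if (n <= m)%N then f (m - n)%N else 0.
Proof.
elim: n m => [|n IHn] m; first by rewrite expr0 mul1r subn0.
rewrite exprS -mulrA coef_fpsXM; case: m => [//|m]; exact: IHn.
Qed.

Lemma coef_fpsXn (R : comNzRingType) n m : (fpsX R ^+ n) m = (m == n)%:R.
Proof.
rewrite -[_ ^+ n]mulr1 coef_fpsXnM coef_fps1.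
case: leqP => [lenm|ltmn]; last by rewrite ltn_eqF.
by rewrite subn_eq0 eqn_leq lenm andbT.
Qed.

Lemma coef_fps_natM (R : comNzRingType) k (f : fps R) m :
  (k%:R * f) m = k%:R * f m.
Proof.
elim: k => [|k IHk]; first by rewrite !mul0r.
by rewrite -addn1 !natrD !mulrDl !mul1r coef_fpsD IHk.
Qed.

Section Summable.
Variable R : comNzRingType.
Implicit Types (a b : nat -> fps R) (c : fps R).

(** The term [a h] is divisible by the h-th power of the variable, so each coefficient of the
    infinite sum is a finite sum: [ssum] cuts it off where the terms vanish. *)
Definition summable a : Prop := forall h m, (m < h)%N -> a h m = 0.

Definition ssum a : fps R := Fps (fun m => \sum_(h < m.+1) a h m).

Lemma ssumE a M m : summable a -> (m < M)%N -> ssum a m = \sum_(h < M) a h m.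
Proof.
move=> sa lmM /=; rewrite -!(big_mkord xpredT (fun h => a h m)).
rewrite [RHS](@big_cat_nat _ _ _ m.+1) //= [X in _ = _ + X]big_nat [X in _ = _ + X]big1 ?addr0 //.
by move=> h /andP[lmh _]; apply: sa.
Qed.

Lemma eq_ssum a b : a =1 b -> ssum a = ssum b.
Proof. by move=> ab; apply/fpsP => m; apply: eq_bigr => h _; rewrite ab. Qed.

Lemma ssumD a b : ssum (fun h => a h + b h) = ssum a + ssum b.
Proof. by apply/fpsP => m; rewrite /= big_split. Qed.

Lemma ssumMl a c : summable a -> ssum (fun h => c * a h) = c * ssum a.
Proof.
move=> sa; apply/fpsP => m; rewrite coef_fpsM /=.
rewrite exchange_big /=; apply: eq_bigr => i _.
have lim : (m - i < m.+1)%N by rewrite ltnS leq_subr.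
by have /= -> := ssumE sa lim; rewrite mulr_sumr.
Qed.

Lemma ssum_recl a : summable a -> ssum a = a 0%N + ssum (fun h => a h.+1).
Proof.
move=> sa; apply/fpsP => m; rewrite coef_fpsD /=.
by have /= -> := ssumE sa (leqnSn m.+1); rewrite big_ord_recl.
Qed.

Lemma summableS a : summable a -> summable (fun h => a h.+1).
Proof. by move=> sa h m lmh; apply: sa; apply: ltnW. Qed.

Lemma summableM a b : summable a -> summable (fun h => a h * b h).
Proof.
move=> sa h m lmh; rewrite coef_fpsM big1 // => i _; rewrite sa ?mul0r //.
by rewrite (leq_trans (ltn_ord i)).
Qed.

Lemma ssum_le1 a : summable a ->
  ssum (fun h => if (h <= 1)%N then a h else 0) = a 0%N + a 1%N.
Proof.
move=> sa; have sb : summable (fun h => if (h <= 1)%N then a h else 0).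
  by move=> h m lmh; case: ifP => // _; apply: sa.
rewrite ssum_recl // ssum_recl; last exact: (summableS sb).
rewrite [ssum _](_ : _ = 0) ?addr0 //.
by apply/fpsP => m; rewrite /= big1.
Qed.

End Summable.

(** * The transfer recurrence *)

(** The U of the outline, refined by the condition [P] on the first column; the index [t] stands for
    t + 1 columns. *)
Definition heap_gf (P : pred nat) (t h : nat) : fps rat :=
  \sum_(w <- heap_words P t h) X ^+ size w.

Lemma coef_heap_gf P t h m :
  heap_gf P t h m = (count (fun w => size w == m) (heap_words P t h))%:R.
Proof.
rewrite coef_fps_sum -sum1_count natr_sum [RHS]big_mkcond /=.
by apply: eq_bigr => w _; rewrite coef_fpsXn eq_sym; case: eqP.
Qed.

Lemma heap_gf0 P h : heap_gf P 0 h = (P h)%:R * X ^+ h.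
Proof.
rewrite /heap_gf /=; case: (P h); first by rewrite big_seq1 size_nseq mul1r.
by rewrite big_nil mul0r.
Qed.

(** A new column with [h] points adds [h] letters, in [step_weight k h] ways by [size_altwords]. The
    weight vanishes for k > h + 1, so any [M] beyond that will do. *)
Lemma heap_gf_rec P t h M : (h.+2 <= M)%N -> heap_gf P t.+1 h =
  X ^+ h * \sum_(k < M) (step_weight k h)%:R * heap_gf P t k.
Proof.
move=> lhM; rewrite -(big_mkord xpredT (fun k => (step_weight k h)%:R * heap_gf P t k)).
rewrite (@big_cat_nat _ _ _ h.+2) //= [X in _ + X]big_nat [X in _ + X]big1 => [|k /andP[lhk _]].
  rewrite addr0 mulr_sumr /heap_gf.
  rewrite (big_allpairs_dep (h := fun _ p => mrg t p.1 p.2)) /=.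
  apply: eq_bigr => k _; rewrite big_allpairs_dep /=.
  rewrite mulr_sumr mulr_sumr big_seq [RHS]big_seq; apply: eq_bigr => w wE.
  have [allw _ _ cw] := heap_words_sound wE.
  rewrite -(size_altwords t) -sum1_size natr_sum mulr_suml mulr_sumr.
  rewrite big_seq [RHS]big_seq.
  apply: eq_bigr => s /mem_altwords[_ alls cs ch].
  by rewrite size_mrg ?cs ?cw // ch addnC exprD mul1r.
have -> : step_weight k h = 0%N by rewrite /step_weight; case: eqVneq; lia.
by rewrite mul0r.
Qed.

Lemma heap_gfS0 P t : heap_gf P t.+1 0 = heap_gf P t 0 + heap_gf P t 1.
Proof.
rewrite (heap_gf_rec P t (leqnn 2)) expr0 mul1r !big_ord_recl big_ord0.
by rewrite /= !mul1r addr0.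
Qed.

Lemma heap_gfSS P t h : heap_gf P t.+1 h.+1 =
  X ^+ h.+1 * (heap_gf P t h + 2 * heap_gf P t h.+1 + heap_gf P t h.+2).
Proof.
rewrite (heap_gf_rec P t (leqnn h.+3)) !big_ord_recr /= big1 => [|k _].
  have -> : step_weight h h.+1 = 1%N by rewrite /step_weight; case: eqVneq; lia.
  have -> : step_weight h.+2 h.+1 = 1%N by rewrite /step_weight; case: eqVneq; lia.
  have -> : step_weight h.+1 h.+1 = 2 by rewrite /step_weight eqxx.
  by rewrite add0r !mul1r.
have -> : step_weight k h.+1 = 0%N.
  by have := ltn_ord k; rewrite /step_weight; case: eqVneq; lia.
by rewrite mul0r.
Qed.

Lemma heap_gf_summable P t : summable (heap_gf P t).
Proof.
move=> h m lmh; case: t => [|t].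
  by rewrite heap_gf0 mulrC coef_fpsXnM leqNgt lmh.
by rewrite (heap_gf_rec P t (leqnn _)) coef_fpsXnM leqNgt lmh.
Qed.

(* The value at z = q^j of the generating function of heap_gf P t h * z^h. *)
Definition heap_gf_at P t j : fps rat :=
  ssum (fun h => heap_gf P t h * X ^+ (j * h)).

(** At z = q^j the factor q^h z^h is y^h with y = q^(j+1). The shifts h - 1, h, h + 1 contribute
    y^2, 2y and 1 to (1 + y)^2; the correction y U(0) comes from c_0 = 1 in place of 2, and U(0)
    from the last shifted sum starting at U(1). *)
Lemma heap_gf_at_rec P t j : X ^+ j.+1 * heap_gf_at P t.+1 j =
  (1 + X ^+ j.+1) ^+ 2 * heap_gf_at P t j.+1 - (1 + X ^+ j.+1) * heap_gf P t 0.
Proof.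
set y := X ^+ j.+1; pose u := heap_gf P t.
have su : summable (fun h => u h * X ^+ (j.+1 * h)).
  exact/summableM/heap_gf_summable.
have su1 := summableS su; have su2 := summableS su1.
have e0 : heap_gf_at P t j.+1 = u 0%N + ssum (fun h => u h.+1 * X ^+ (j.+1 * h.+1)).
  by rewrite /heap_gf_at ssum_recl // muln0 expr0 mulr1.
have e1 : ssum (fun h => u h.+1 * X ^+ (j.+1 * h.+1)) =
    u 1%N * y + ssum (fun h => u h.+2 * X ^+ (j.+1 * h.+2)).
  by rewrite ssum_recl // muln1.
have e2 : y * heap_gf_at P t.+1 j = y * u 0%N + y * u 1%N
    + y ^+ 2 * heap_gf_at P t j.+1
    + 2 * y * ssum (fun h => u h.+1 * X ^+ (j.+1 * h.+1))
    + ssum (fun h => u h.+2 * X ^+ (j.+1 * h.+2)).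
  rewrite /heap_gf_at ssum_recl; last exact/summableM/heap_gf_summable.
  rewrite muln0 expr0 mulr1 heap_gfS0 !mulrDr -!addrA; congr (_ + (_ + _)).
  rewrite -ssumMl; last exact/(summableS (a := fun h => heap_gf P t.+1 h * X ^+ (j * h)))/summableM/heap_gf_summable.
  rewrite -[y ^+ 2 * _]ssumMl // -[2 * y * _]ssumMl // -!ssumD.
  apply: eq_ssum => h; rewrite heap_gfSS -/(u _) -/(u h.+1) -/(u h.+2) /y.
  rewrite !mulnS !mulSn !exprD !exprS.
  ring.
rewrite e2 e0 e1 -/(u 0%N); ring.
Qed.

Lemma heap_gf_at0_all j : (1 - X ^+ j.+1) * heap_gf_at xpredT 0 j = 1.
Proof.
have s1 : summable (fun h => heap_gf xpredT 0 h * X ^+ (j * h)).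
  exact/summableM/heap_gf_summable.
suff e : heap_gf_at xpredT 0 j = 1 + X ^+ j.+1 * heap_gf_at xpredT 0 j.
  by rewrite mulrBl mul1r {1}e addrK.
rewrite {1}/heap_gf_at ssum_recl // muln0 expr0 mulr1 heap_gf0 mul1r expr0.
congr (_ + _); rewrite -ssumMl //; apply: eq_ssum => h.
by rewrite !heap_gf0 !mul1r mulnS -!exprD; congr (X ^+ _); lia.
Qed.

Lemma heap_gf_at0_le1 j : heap_gf_at (fun c => (c <= 1)%N) 0 j = 1 + X ^+ j.+1.
Proof.
rewrite /heap_gf_at -[RHS](_ : X ^+ 0 * X ^+ (j * 0) + X ^+ 1 * X ^+ (j * 1) = _).
  rewrite -(@ssum_le1 _ (fun h => X ^+ h * X ^+ (j * h))).
    apply: eq_ssum => h; rewrite heap_gf0; case: ifP => _; first by rewrite mul1r.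
    by rewrite !mul0r.
  by apply: summableM => h m lmh; rewrite coef_fpsXn ltn_eqF.
by rewrite muln0 muln1 mul1r -exprD add1n.
Qed.

(** * Symmetry under reversal of the path *)

(** The heaps are sorted by the number [a] of points in the first column; for general [P] this sum
    is finite only coefficientwise. *)
Lemma heap_gf_sumr P t h m M : (m < M)%N ->
  heap_gf P t h m = \sum_(a < M | P a) heap_gf (pred1 (a : nat)) t h m.
Proof.
elim: t h m => [|t IHt] h m lmM.
  rewrite heap_gf0 coef_fps_natM coef_fpsXn.
  under eq_bigr do rewrite heap_gf0 coef_fps_natM coef_fpsXn.
  have [emh|nmh] := eqVneq m h; last first.
    by rewrite mulr0 big1 // => a _; rewrite mulr0.
  rewrite -emh big_mkcond (bigD1 (Ordinal lmM)) //= eqxx big1 ?addr0.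
    by case: (P m); rewrite ?mul1r ?mul0r.
  move=> a nam; rewrite (_ : (m == a) = false) ?mul0r ?if_same //.
  by apply/negP => /eqP ema; case/eqP: nam; apply: val_inj.
rewrite (heap_gf_rec P t (leqnn _)) coef_fpsXnM.
under [RHS]eq_bigr do rewrite (heap_gf_rec _ t (leqnn _)) coef_fpsXnM.
case: ifP => _; last by rewrite big1.
rewrite coef_fps_sum; under [RHS]eq_bigr do rewrite coef_fps_sum.
rewrite [RHS]exchange_big; apply: eq_bigr => k _.
rewrite coef_fps_natM IHt ?(leq_ltn_trans (leq_subr _ _)) // mulr_sumr.
by apply: eq_bigr => a _; rewrite coef_fps_natM.
Qed.

(** In a product of transfer matrices the first factor can be split off as well as the last. The
    induction on [t] splits off the last factor and exchanges the two sums. *)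
Lemma heap_gf_recl t a h M : (a.+2 <= M)%N -> heap_gf (pred1 a) t.+1 h =
  X ^+ a * \sum_(k < M) (step_weight a k)%:R * heap_gf (pred1 (k : nat)) t h.
Proof.
move=> laM; elim: t h => [|t IHt] h.
  have -> : heap_gf (pred1 a) 1 h = (step_weight a h)%:R * X ^+ a * X ^+ h.
    have lhM : (h.+2 <= (a + h).+2)%N by rewrite !ltnS leq_addl.
    have laM' : (a < (a + h).+2)%N by rewrite ltnS leqW ?leq_addr.
    rewrite (heap_gf_rec _ _ lhM) (bigD1 (Ordinal laM')) //= big1 => [|k nka].
      by rewrite heap_gf0 /= eqxx mul1r addr0; ring.
    by rewrite heap_gf0 /= (_ : (_ == _) = false) ?mul0r ?mulr0 //; apply: negPf.
  have [lhM|leMh] := ltnP h M; last first.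
    rewrite (_ : step_weight a h = 0%N); last first.
      by rewrite /step_weight; case: eqVneq; lia.
    rewrite !mul0r big1 ?mulr0 // => k _; rewrite heap_gf0 /= gtn_eqF ?mul0r ?mulr0 //.
    exact: leq_trans (ltn_ord k) leMh.
  rewrite (bigD1 (Ordinal lhM)) //= big1 => [|k nkh]; last first.
    rewrite heap_gf0 /= (_ : (_ == _) = false) ?mul0r ?mulr0 // eq_sym.
    exact: negPf.
  by rewrite heap_gf0 /= eqxx mul1r addr0; ring.
rewrite (heap_gf_rec _ _ (leqnn _)).
under eq_bigr do rewrite IHt mulrCA mulr_sumr.
rewrite -mulr_sumr exchange_big mulrCA; congr (_ * _); rewrite mulr_sumr.
apply: eq_bigr => l _; rewrite (heap_gf_rec _ _ (leqnn _)) mulrCA; congr (_ * _).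
by rewrite mulr_sumr; apply: eq_bigr => k _; rewrite mulrCA.
Qed.

(** The transfer weights are symmetric, so the recurrences from the last and from the first column
    turn into each other when [a] and [h] are exchanged. *)
Lemma heap_gf_sym t a h : heap_gf (pred1 a) t h = heap_gf (pred1 h) t a.
Proof.
elim: t a h => [|t IHt] a h.
  by rewrite !heap_gf0 /= eq_sym; case: eqVneq => [->|]; rewrite ?mul0r.
rewrite (heap_gf_rec _ _ (leqnn _)) (heap_gf_recl _ _ (leqnn _)); congr (_ * _).
by apply: eq_bigr => k _; rewrite step_weightC IHt.
Qed.

Lemma heap_gf_reverse t : heap_gf xpredT t 0 + heap_gf xpredT t 1 =
  ssum (heap_gf (fun c => (c <= 1)%N) t).
Proof.
apply/fpsP => m; rewrite coef_fpsD /= !(@heap_gf_sumr _ _ _ m m.+1) // -big_split.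
apply: eq_bigr => a _ /=.
(* The bound m + 2 rather than m + 1 keeps both 0 and 1 in range when m = 0. *)
rewrite (@heap_gf_sumr (fun c => (c <= 1)%N) _ _ m m.+2) //.
rewrite big_mkcond !big_ord_recl big1 // /= addr0.
by rewrite !(heap_gf_sym _ (a : nat)).
Qed.

(** * The series of the theorem *)

Lemma q_neq0 : q != 0.
Proof.
rewrite tofrac_eq0; apply/eqP => /fpsP/(_ 1%N)/eqP.
by rewrite /= oner_eq0.
Qed.

Lemma qn_neq0 n : q ^+ n != 0.
Proof. by rewrite expf_neq0 ?q_neq0. Qed.

Lemma subr1_qn_neq0 n : 1 - q ^+ n.+1 != 0.
Proof.
rewrite -tofrac1 -tofracXn -tofracB tofrac_eq0; apply/eqP => /fpsP/(_ 0%N)/eqP.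
by rewrite coef_fpsB coef_fpsXn coef_fps1 coef_fps0 /= subr0 oner_eq0.
Qed.

(** Unrolling lowers the number of steps [t] while raising the point [j]; the l-th summand is the
    boundary term [u] met after [l] steps. *)
Lemma transfer_solve (F : fieldType) (y : nat -> F) (w : nat -> nat -> F)
    (u : nat -> F) : (forall j, y j != 0) ->
  (forall t j, y j * w t.+1 j = (1 + y j) ^+ 2 * w t j.+1 - (1 + y j) * u t) ->
  forall t j, w t j =
    \prod_(i < t) ((1 + y (j + i)%N) ^+ 2 / y (j + i)%N) * w 0%N (j + t)%N -
    \sum_(l < t) \prod_(i < l) ((1 + y (j + i)%N) ^+ 2 / y (j + i)%N)
       * ((1 + y (j + l)%N) / y (j + l)%N) * u (t.-1 - l)%N.
Proof.
move=> y0 wE; elim=> [|t IHt] j; first by rewrite !big_ord0 mul1r addn0 subr0.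
have prodS l : \prod_(i < l.+1) ((1 + y (j + i)%N) ^+ 2 / y (j + i)%N) =
    (1 + y j) ^+ 2 / y j *
    \prod_(i < l) ((1 + y (j.+1 + i)%N) ^+ 2 / y (j.+1 + i)%N).
  rewrite big_ord_recl addn0; congr (_ * _).
  by apply: eq_bigr => i _; rewrite addnS addSn.
apply: (mulfI (y0 j)); rewrite wE IHt prodS big_ord_recl big_ord0 addn0 subn0.
rewrite addSnnS; set s := \sum_(i < t) _; set s' := \sum_(i < t) _.
have -> : s' = (1 + y j) ^+ 2 / y j * s.
  rewrite /s mulr_sumr; apply: eq_bigr => l _.
  rewrite prodS addnS -addSn -!mulrA.
  by have -> : (t.+1.-1 - lift ord0 l = t.-1 - l)%N by rewrite /= /bump; lia.
by field.
Qed.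

Definition transfer_coef l : laurent :=
  \prod_(i < l) ((1 + q ^+ i.+1) ^+ 2 / q ^+ i.+1).

Lemma qpochS l : qpoch (- q) l.+1 = qpoch (- q) l * (1 + q ^+ l.+1).
Proof. by rewrite /qpoch big_ord_recr; rewrite mulNr opprK -exprS. Qed.

Lemma transfer_coefE l :
  transfer_coef l = q ^- 'C(l.+1, 2) * qpoch (- q) l ^+ 2.
Proof.
elim: l => [|l IHl].
  by rewrite /transfer_coef /qpoch !big_ord0 expr0 invr1 expr1n mulr1.
rewrite /transfer_coef big_ord_recr -/(transfer_coef l) IHl qpochS.
rewrite [in RHS]binS bin1 exprD invfM exprMn mulrACA; congr (_ * _).
exact: mulrC.
Qed.

Lemma S_seriesS l :
  S_series l.+1 = transfer_coef l * ((1 + q ^+ l.+1) / q ^+ l.+1).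
Proof.
have -> : S_series l.+1 =
  q ^- 'C(l.+2, 2) * qpoch (- q) l * qpoch (- q) l.+1 by [].
rewrite transfer_coefE [in LHS]binS bin1 exprD invfM qpochS expr2.
have aux (F : fieldType) (a b p r : F) :
  a * b * p * (p * r) = a * (p * p) * (r * b) by ring.
exact: aux.
Qed.

Lemma N_seriesS t : N_series t.+1 = transfer_coef t / (1 - q ^+ t.+1).
Proof.
have -> : N_series t.+1 =
  q ^- 'C(t.+1, 2) * (qpoch (- q) t ^+ 2 / (1 - q ^+ t.+1)) by [].
by rewrite transfer_coefE mulrA.
Qed.

Lemma ssum_heap_gf P t : laurent_of_fps (ssum (heap_gf P t)) =
  transfer_coef t * laurent_of_fps (heap_gf_at P 0 t) -
  \sum_(l < t) S_series l.+1 * laurent_of_fps (heap_gf P (t.-1 - l) 0).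
Proof.
have <- : heap_gf_at P t 0 = ssum (heap_gf P t).
  by apply: eq_ssum => h; rewrite mul0n mulr1.
pose w t j := laurent_of_fps (heap_gf_at P t j).
pose u t := laurent_of_fps (heap_gf P t 0).
have wE t' j : q ^+ j.+1 * w t'.+1 j =
    (1 + q ^+ j.+1) ^+ 2 * w t' j.+1 - (1 + q ^+ j.+1) * u t'.
  rewrite /w /u /q -!tofracXn -!tofrac1 -!tofracD -!tofracXn -!tofracM -tofracB.
  by rewrite heap_gf_at_rec.
rewrite -/(w t 0%N) (transfer_solve (fun j => qn_neq0 j.+1) wE).
by congr (_ - _); apply: eq_bigr => l _; rewrite S_seriesS.
Qed.

Lemma coef_XSM (F : fps laurent) t : (fpsX laurent * S_series * F) t.+1 =
  \sum_(l < t) S_series l.+1 * F (t.-1 - l)%N.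
Proof.
rewrite -mulrA coef_fpsXM coef_fpsM big_ord_recl mul0r add0r.
by apply: eq_bigr => l _; congr (_ * F _); rewrite /= /bump; lia.
Qed.

(** * Coefficients of the three series in terms of heaps *)

Lemma size_heap_list_gf P P' t : Fps (fun m => (size (heap_list P P' t m))%:R) =
  ssum (fun h => if P' h then heap_gf P t h else 0).
Proof.
apply/fpsP => m; rewrite /= size_heap_list natr_sum big_mkcond.
by apply: eq_bigr => h _; case: (P' h); rewrite ?coef_heap_gf.
Qed.

(** Covers the empty path, since [heap_list] always has at least one column. *)
Lemma rep_system0 m (Q : pred (seq 'I_0)) : Q [::] ->
  rep_system m Q (nseq (m == 0%N) [::]).
Proof.
move=> Q0; have nil (v : seq 'I_0) : v = [::] by case: v => [//|[]].
split=> [|w|v _ <-|u v _ _ _]; first by case: (m == 0%N).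
- by case: eqP => [->|//]; rewrite inE => /eqP ->.
- by exists [::]; rewrite ?(nil v) ?mem_head //; apply: rst_refl.
- by rewrite (nil u) (nil v).
Qed.

Lemma nseq_fps1 (T : Type) (x : T) :
  Fps (fun m => (size (nseq (m == 0%N) x))%:R) = 1 :> fps rat.
Proof. by apply/fpsP => m; rewrite /= size_nseq. Qed.

(** [alternating] and [last_column_le1] each provide their own witness word; invariance over the
    class lets one word serve both. *)
Lemma card_alternating_le1 n m l :
  rep_system m (heap_pred xpredT (fun c => (c <= 1)%N) (n := n)) l ->
  #|[set H in heaps n m | alternating H && last_column_le1 H]| = size l.
Proof.
move/card_heaps => <-; apply: eq_card => H; rewrite !inE.
have [HH|//] := boolP (H \in heaps n m).
rewrite last_column_le1P // /alternating /heap_pred /=; apply/andP/existsP.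
  case=> /existsP[w /andP[wH aw]] /forall_inP cw; exists w.
  by rewrite wH aw cw.
case=> w /and3P[wH aw cw]; split; first by apply/existsP; exists w; rewrite wH.
by rewrite -last_column_le1P //; apply/existsP; exists w; rewrite wH.
Qed.

Lemma card_alternating n m l : rep_system m (heap_pred xpredT xpredT (n := n)) l ->
  #|[set H in heaps n m | alternating H]| = size l.
Proof.
move/card_heaps => <-; apply: eq_card => H; rewrite !inE; congr (_ && _).
by apply: eq_existsb => w; rewrite /heap_pred !andbT.
Qed.

(** The index [n] stands for n + 1 columns with the last one empty; deleting it leaves at most one
    point in column n. This form includes n = 0. *)
Lemma Ba_seriesE n : Ba_series n = laurent_of_fps (heap_gf xpredT n 0).
Proof.
rewrite /Ba_series /=; congr laurent_of_fps; case: n => [|t].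
  rewrite heap_gf0 mul1r expr0 -(nseq_fps1 (Nil 'I_0)); congr Fps.
  apply/funext => m; congr (_%:R); apply: card_alternating_le1.
  by apply: rep_system0; rewrite /heap_pred !andbT; apply/alternating_wordP.
rewrite heap_gfS0 -ssum_le1; last exact: heap_gf_summable.
rewrite -size_heap_list_gf; congr Fps; apply/funext => m; congr (_%:R).
by apply: card_alternating_le1; apply: heap_list_rep.
Qed.

Lemma L_seriesS t : L_series t.+1 = laurent_of_fps (ssum (heap_gf xpredT t)).
Proof.
rewrite /L_series /=; congr laurent_of_fps.
rewrite -[RHS](size_heap_list_gf xpredT xpredT); congr Fps; apply/funext => m.
by congr (_%:R); apply: card_alternating; apply: heap_list_rep.
Qed.

Lemma A_seriesE n : A_series n = laurent_of_fps (heap_gf (fun c => (c <= 1)%N) n 0).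
Proof.
rewrite /A_series /=.
under eq_bigr do rewrite -tofracXn.
rewrite -(rmorph_sum laurent_of_fps); congr laurent_of_fps.
suff e l : (forall m, rep_system m (@fc_word n) (l m)) ->
    \sum_(g : 'S_n.+1 | `[< fully_commutative g >]) X ^+ cox_length g =
    Fps (fun m => (size (l m))%:R).
  case: n e => [|t] e.
    rewrite heap_gf0 mul1r expr0 -(nseq_fps1 (Nil 'I_0)); apply: e => m.
    apply: rep_system0; rewrite /fc_word /heap_pred !andbT.
    exact/alternating_wordP.
  rewrite heap_gfS0 -ssum_le1; last exact: heap_gf_summable.
  by rewrite -size_heap_list_gf; apply: e => m; apply: heap_list_rep.
move=> repl; apply/fpsP => m; rewrite coef_fps_sum /=.
rewrite -(card_fully_commutative (repl m)) -sum1_card natr_sum.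
rewrite big_mkcond [RHS]big_mkcond; apply: eq_bigr => g _.
by rewrite inE coef_fpsXn eq_sym; case: `[< _ >] => //=; case: eqP.
Qed.

Theorem theorem6p2 :
  [/\ S_series = fps_scale q^-1 N_series - fps_scale q N_series,
      Ba_series = 1 + fps_scale q S_series - fpsX laurent * S_series * A_series
    & L_series = N_series - fpsX laurent * S_series * Ba_series].
Proof.
split; apply/fpsP => -[|t].
- by rewrite coef_fpsB /= !mulr0 subr0.
- rewrite coef_fpsB.
  have scaleE (c : laurent) (f : fps laurent) n :
    fps_scale c f n = c ^+ n * f n by [].
  rewrite !scaleE S_seriesS N_seriesS exprVn -mulrBl.
  have aux (F : fieldType) (a c : F) : a != 0 -> 1 - a != 0 ->
      c * ((1 + a) / a) = (a^-1 - a) * (c / (1 - a)).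
    by move=> a0 a1; field; rewrite a0 a1.
  by apply: aux; [apply: qn_neq0 | apply: subr1_qn_neq0].
- rewrite coef_fpsB coef_fpsD -mulrA coef_fpsXM Ba_seriesE heap_gf0 /= mulr0.
  by rewrite mul1r expr0 tofrac1 addr0 subr0.
(* Reversal moves the bound from the last column to the first, so that the initial column has value
   1 + q^(t+1) and the subtracted terms are coefficients of A. *)
- rewrite coef_fpsB coef_fpsD coef_XSM Ba_seriesE heap_gfS0 heap_gf_reverse.
  rewrite ssum_heap_gf heap_gf_at0_le1 tofracD tofrac1 tofracXn -/q add0r.
  congr (_ - _); last by apply: eq_bigr => l _; rewrite A_seriesE.
  (* The factor q^(t+1) from the substitution xq cancels the denominator in [S_seriesS]. *)
  rewrite -[RHS]/(q ^+ t.+1 * S_series t.+1) S_seriesS [RHS]mulrCA; congr (_ * _).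
  by rewrite mulrCA divff ?mulr1 ?qn_neq0.
- by rewrite coef_fpsB -mulrA coef_fpsXM /= subr0.
(* The first column is free here: the initial value is 1 / (1 - q^(t+1)), and the subtracted terms,
   with empty last column, are coefficients of B. *)
rewrite coef_fpsB coef_XSM L_seriesS ssum_heap_gf N_seriesS.
congr (_ - _); last by apply: eq_bigr => l _; rewrite Ba_seriesE.
congr (_ * _); apply: (mulfI (subr1_qn_neq0 t)); rewrite divff ?subr1_qn_neq0 //.
by rewrite -tofrac1 -tofracXn -tofracB -tofracM heap_gf_at0_all.
Qed.
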